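(* Let $\gamma:[a,b]\to\mathbb R$ be a convex Lipschitz function on a compact interval and let $\Gamma$ be its graph. Write the Lebesgue decomposition of the distributional second derivative of $\gamma$ as \[ D^2\gamma=k(x)\,dx+\kappa_s, \] where $k(x)\,dx$ is absolutely continuous and $\kappa_s$ is singular with respect to Lebesgue measure. If \[ |\{x:k(x)>0\}|>0, \] then $T(\Gamma)=1$.
   Context: For convex Lipschitz $\gamma$, $D^2\gamma$ is a finite positive Borel measure on $(a,b)$ (the distributional derivative of the nondecreasing right derivative $\gamma'_+$). For a compact curve $\Gamma\subset\mathbb R^2$, \[ T(\Gamma)=\inf\{t:\ \dim_{\mathrm H}(E)>t\Longrightarrow|E+\Gamma|>0\ \text{ for every compact }E\subset\mathbb R^2\}, \] where $E+\Gamma=\{x+y:x\in E,\ y\in\Gamma\}$, $|\cdot|$ denotes Lebesgue measure in the ambient dimension, and $\dim_{\mathrm H}$ is Hausdorff dimension. *)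

(* Defs.v *)
From HB Require Import structures.
From mathcomp Require Import all_boot all_order all_algebra.
From mathcomp Require Import all_classical all_reals all_analysis.

Set Implicit Arguments.
Unset Strict Implicit.
Unset Printing Implicit Defensive.

Import Order.TTheory GRing.Theory Num.Theory.
Import numFieldNormedType.Exports.

Local Open Scope classical_set_scope.
Local Open Scope ring_scope.

(* The norm of MathComp-Analysis on [R * R] is the sup norm, so the Euclidean
   distance of the plane is spelled out. *)
Definition plane_dist (R : realType) (p q : R * R) : R :=
  Num.sqrt ((p.1 - q.1) ^+ 2 + (p.2 - q.2) ^+ 2).

Definition diam (R : realType) (A : set (R * R)) : \bar R :=
  ereal_sup [set (plane_dist p q)%:E | p in A & q in A].

(* [diam set0] is [-oo] and [poweR _ 0] is 1; the empty set must count for 0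
   in the sums below, also for [s = 0]. *)
Definition diam_pow (R : realType) (s : R) (A : set (R * R)) : \bar R :=
  if A == set0 then 0%E else poweR (diam A) s.

Definition hausdorff_premeasure (R : realType) (s delta : R)
    (E : set (R * R)) : \bar R :=
  ereal_inf [set (\sum_(0 <= i <oo) diam_pow s (U i))%E |
    U in [set U : nat -> set (R * R) |
      E `<=` \bigcup_i U i /\ forall i, (diam (U i) <= delta%:E)%E]].

Definition hausdorff_measure (R : realType) (s : R) (E : set (R * R)) :
    \bar R :=
  ereal_sup [set hausdorff_premeasure s delta E |
    delta in [set delta : R | 0 < delta]].

Definition hausdorff_dim (R : realType) (E : set (R * R)) : \bar R :=
  ereal_inf [set s%:E | s in
    [set s : R | 0 <= s /\ hausdorff_measure s E = 0%E]].

Definition plane_lebesgue (R : realType) (A : set (R * R)) : \bar R :=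
  ((@lebesgue_measure R) \x (@lebesgue_measure R))%E A.

Definition minkowski_sum (R : realType) (A B : set (R * R)) : set (R * R) :=
  [set x + y | x in A & y in B].

Definition curve_threshold (R : realType) (Gamma : set (R * R)) : \bar R :=
  ereal_inf [set t%:E | t in
    [set t : R | forall E : set (R * R), compact E ->
      (t%:E < hausdorff_dim E)%E ->
      (0 < plane_lebesgue (minkowski_sum E Gamma))%E]].

Definition graph_on (R : realType) (a b : R) (gamma : R -> R) : set (R * R) :=
  [set (x, gamma x) | x in `[a, b]].

Definition right_derivative (R : realType) (f : R -> R) (x : R) : R :=
  lim ((f (x + h) - f x) / h @[h --> 0^'+]).

Definition test_function (R : realType) (a b : R) (phi : R -> R) : Prop :=
  [/\ forall (n : nat) (x : R), derivable (derive1n n phi) x 1,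
      compact (closure [set x | phi x != 0]) &
      closure [set x | phi x != 0] `<=` `]a, b[].

Definition distributional_derivative (R : realType) (a b : R) (f : R -> R)
    (mu : {measure set (measurableTypeR R) -> \bar R}) : Prop :=
  forall phi : R -> R, test_function a b phi ->
    (\int[mu]_(x in `]a, b[) (phi x)%:E =
     - \int[lebesgue_measure]_(x in `]a, b[) (f x * derive1 phi x)%:E)%E.

(* Borel measures on ]a, b[ are represented by Borel measures on R of which
   only the restriction to ]a, b[ is constrained. *)
Definition is_D2 (R : realType) (a b : R) (gamma : R -> R)
    (mu : {finite_measure set (measurableTypeR R) -> \bar R}) : Prop :=
  distributional_derivative a b (right_derivative gamma) mu.

Definition singular_on (R : realType) (a b : R)
    (mu nu : {measure set (measurableTypeR R) -> \bar R}) : Prop :=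
  exists N : set (measurableTypeR R),
    [/\ measurable N, N `<=` `]a, b[, nu N = 0%E & mu (`]a, b[ `\` N) = 0%E].

Definition lebesgue_decomposition (R : realType) (a b : R)
    (mu : {measure set (measurableTypeR R) -> \bar R}) (k : R -> R)
    (kappa_s : {measure set (measurableTypeR R) -> \bar R}) : Prop :=
  [/\ lebesgue_measure.-integrable `]a, b[ (EFin \o k),
      singular_on a b kappa_s lebesgue_measure &
      forall A : set (measurableTypeR R), measurable A -> A `<=` `]a, b[ ->
        mu A = (\int[lebesgue_measure]_(x in A) (k x)%:E + kappa_s A)%E].

(* Main.v *)
Require Import Defs.
From mathcomp Require Import all_boot all_order all_algebra.
From mathcomp Require Import all_classical all_reals all_analysis.
From mathcomp Require Import measurable_realfun.
From mathcomp Require Import ring lra zify.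

Set Implicit Arguments.
Unset Strict Implicit.
Unset Printing Implicit Defensive.

Import Order.TTheory GRing.Theory Num.Theory.
Import numFieldNormedType.Exports.

Local Open Scope classical_set_scope.
Local Open Scope ring_scope.

(** Both inequalities are proved directly.

    The threshold is at least [1] because a vertical Cantor set of ratio
    [x < 1 / 2] has dimension [s], where [2 * x `^ s = 1], and this
    [s] can be any number between [0] and [1]; its sum with a graph has null
    vertical sections, hence measure zero ([cantor_segment_sum_null],
    [cantor_segment_dim_ge]).

    For the other inequality let [E] be compact of dimension greater than [1].
    If a measure on [E] has finite energy of dimension one and is convolved
    with a measure on the curve, then the result has a square integrable
    density, provided that the differences of points of the curve are
    distributed with a density of order at most [1 / |z|]. For this it
    suffices to use the part of the curve above a well chosen compact set [K]
    of positive measure. Two translates by vectors with horizontal difference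
    [h] come vertically close where the increment
    [gamma (t + h) - gamma t] stays in a short interval. This increment
    is monotone in [t] by convexity, and it grows at rate at least [eta * h]
    at points of [K] if the right derivative of [gamma] increases by at least
    [eta * h] from each point of [K] to the point at distance [h] on its
    right ([second_difference_ge], [measure_level_strip]). Such a [K] exists:
    the second derivative of [gamma] dominates [c] times Lebesgue measure on
    the set where [k >= c], testing it against smooth bumps turns this into
    a lower bound for the increments of the right derivative
    ([D2_lower_bound]), and Lebesgue's density theorem makes the bound uniform
    over all scales on a compact subset ([density_compact]).

    The convolution argument is carried out at each scale [2 ^- n] with
    finitely many points in place of a measure on [E]. Greedy weights on
    points of [E] give a discrete form of Frostman's lemma
    ([discrete_frostman]); their energy is bounded uniformly in [n] since the
    dimension exceeds one ([dyadic_energy_le]); the Cauchy-Schwarz inequality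
    then bounds the measure of a union of thickened translates of the curve
    from below ([measure_cover_ge], [thick_union_ge]), and the thickness tends
    to zero ([plane_lebesgue_gt0]). *)

(** * Slopes of convex functions *)

Section ConvexSlopes.
Variables (R : realType) (a b : R) (gamma : R -> R).
Hypothesis convex : convex_function `[a, b] gamma.

Lemma convex_three_point s t u : a <= s -> s < t -> t < u -> u <= b ->
  gamma t * (u - s) <= gamma s * (u - t) + gamma u * (t - s).
Proof.
move=> a_s st tu ub.
have su : 0 < u - s by lra.
have p0 : 0 <= (u - t) / (u - s) by rewrite divr_ge0//; lra.
have p1 : (u - t) / (u - s) <= 1 by rewrite ler_pdivrMr//; lra.
have smem : s \in `[a, b]%classic by rewrite inE/= in_itv/=; lra.
have umem : u \in `[a, b]%classic by rewrite inE/= in_itv/=; lra.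
set p := (u - t) / (u - s) in p0 p1.
have : gamma (p * s + (1 - p) * u) <= p * gamma s + (1 - p) * gamma u.
  exact: (convex (Itv01 p0 p1) smem umem).
have -> : p * s + (1 - p) * u = t by rewrite /p; field; lra.
rewrite -(ler_pM2r su); congr (_ <= _).
by rewrite /p; field; lra.
Qed.

Let g := right_derivative gamma.

(** The difference quotients of a convex function increase with the step, so
    the limit defining the right derivative is their infimum and exists as
    soon as they are bounded below. *)
Lemma right_derivative_inf x : a <= x -> x < b ->
  has_lbound [set (gamma (x + h) - gamma x) / h | h in `]0, b - x]] ->
  g x = inf [set (gamma (x + h) - gamma x) / h | h in `]0, b - x]].
Proof.
move=> ax xb lb; apply: cvg_lim => //.
apply: (@nondecreasing_at_right_cvgr _ _ _ (BRight (b - x))) => //.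
  by rewrite bnd_simp; lra.
move=> h k; rewrite !in_itv/= => /andP[h0 hb] /andP[k0 kb].
rewrite le_eqVlt => /predU1P[->//|hk].
rewrite ler_pdivrMr// mulrAC ler_pdivlMr//.
have := @convex_three_point x (x + h) (x + k); lra.
Qed.

(** Together with the next lemma: the right derivative at either end of a
    chord brackets the slope of the chord. All later use of convexity goes
    through these two inequalities. *)
Lemma right_derivative_le x t : a < x -> x < t -> t <= b ->
  g x * (t - x) <= gamma t - gamma x.
Proof.
move=> ax xt tb; rewrite -ler_pdivlMr ?subr_gt0//.
have lb : has_lbound [set (gamma (x + h) - gamma x) / h | h in `]0, b - x]].
  exists ((gamma x - gamma a) / (x - a)) => _ [h + <-].
  rewrite /= in_itv/= => /andP[h0 hb].
  rewrite ler_pdivlMr// mulrAC ler_pdivrMr ?subr_gt0//.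
  have := @convex_three_point a x (x + h); lra.
rewrite right_derivative_inf//; [|lra|lra].
apply: ge_inf => //; exists (t - x); first by rewrite /= in_itv/=; lra.
by rewrite subrKC.
Qed.

Lemma right_derivative_ge s x : a <= s -> s < x -> x < b ->
  gamma x - gamma s <= g x * (x - s).
Proof.
move=> a_s sx xb; rewrite -ler_pdivrMr ?subr_gt0//.
have lb h : 0 < h -> h <= b - x ->
    (gamma x - gamma s) / (x - s) <= (gamma (x + h) - gamma x) / h.
  move=> h0 hb; rewrite ler_pdivlMr// mulrAC ler_pdivrMr ?subr_gt0//.
  have := @convex_three_point s x (x + h); lra.
rewrite right_derivative_inf//; [|lra|].
  apply: lb_le_inf.
    by exists ((gamma (x + (b - x)) - gamma x) / (b - x)), (b - x) => //=;
      rewrite in_itv/=; lra.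
  by move=> _ [h + <-]; rewrite /= in_itv/= => /andP[h0 hb]; exact: lb.
exists ((gamma x - gamma s) / (x - s)) => _ [h + <-].
by rewrite /= in_itv/= => /andP[h0 hb]; exact: lb.
Qed.

Lemma right_derivative_nondecreasing x y : a < x -> x <= y -> y < b ->
  g x <= g y.
Proof.
move=> ax; rewrite le_eqVlt => /predU1P[->//|xy] yb.
have yx : 0 < y - x by lra.
rewrite -(ler_pM2r yx).
apply: le_trans (right_derivative_le ax xy (ltW yb)) _.
by apply: right_derivative_ge => //; exact: ltW.
Qed.

End ConvexSlopes.

(** * Smooth functions and bumps *)

Section SmoothFunctions.
Variable R : realType.
Implicit Types f g : R -> R.

(** The recursion passes to the derivative first, so that closure under
    products follows by induction from the product rule, without a formula for
    iterated derivatives of a product. *)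
Fixpoint times_derivable n f : Prop :=
  (forall x, derivable f x 1) /\
  (if n is m.+1 then times_derivable m (derive1 f) else True).

Definition smooth f := forall n, times_derivable n f.

Lemma smooth_derivable f : smooth f -> forall x, derivable f x 1.
Proof. by move=> /(_ 0)[]. Qed.

Lemma smooth_derive1 f : smooth f -> smooth (derive1 f).
Proof. by move=> sf n; have [] := sf n.+1. Qed.

Lemma smooth_derive1n f n x : smooth f -> derivable (derive1n n f) x 1.
Proof.
elim: n f => [|n IH] f sf; first exact: smooth_derivable.
by rewrite derive1Sn; apply/IH/smooth_derive1.
Qed.

Lemma times_derivableD n f g : times_derivable n f -> times_derivable n g ->
  times_derivable n (f + g).
Proof.
elim: n f g => [|n IH] f g [df sf] [dg sg].
  by split=> [x|//]; exact: (derivableD (df x) (dg x)).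
split; first by move=> x; exact: (derivableD (df x) (dg x)).
have -> : derive1 (f + g) = derive1 f + derive1 g.
  by apply/funext => x; rewrite derive1E (deriveD (df x) (dg x)) -2!derive1E.
exact: IH.
Qed.

Lemma times_derivableW n f : times_derivable n.+1 f -> times_derivable n f.
Proof.
elim: n f => [|n IH] f [df sf]; split; [exact: df|by []|exact: df|].
exact: IH.
Qed.

Lemma times_derivableM n f g : times_derivable n f -> times_derivable n g ->
  times_derivable n (f * g).
Proof.
elim: n f g => [|n IH] f g sf sg.
  by split=> [x|//]; exact: (derivableM (sf.1 x) (sg.1 x)).
have [df sf'] := sf; have [dg sg'] := sg.
split; first by move=> x; exact: (derivableM (df x) (dg x)).
have -> : derive1 (f * g) = (f * derive1 g) + (g * derive1 f).
  by apply/funext => x; rewrite derive1E (deriveM (df x) (dg x)) -2!derive1E.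
by apply: times_derivableD; apply: IH => //; apply: times_derivableW.
Qed.

Lemma smoothM f g : smooth f -> smooth g -> smooth (f * g).
Proof. by move=> sf sg n; apply: times_derivableM. Qed.

End SmoothFunctions.

Section FlatFunction.
Variable R : realType.
Implicit Types (c u v : R) (P : {poly R}).

(** Exponential decay beats polynomial growth; each factor of the variable is
    paid for with half of the exponent. *)
Lemma poly_expR_bounded P c : 0 < c ->
  exists2 C, 0 <= C & forall v, 0 < v -> `|P.[v]| * expR (- (c * v)) <= C.
Proof.
elim/poly_ind: P c => [|P a IH] c c0.
  by exists 0 => // v _; rewrite horner0 normr0 mul0r.
have c20 : 0 < c / 2 by rewrite divr_gt0.
have [C C0 PC] := IH _ c20.
exists (C * (2 / c) + `|a|); first by rewrite addr_ge0// mulr_ge0// divr_ge0// ltW.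
move=> v v0; rewrite hornerMXaddC.
have e1 : expR (- (c * v)) <= 1.
  by rewrite -[leRHS]expR0 ler_expR oppr_le0 mulr_ge0// ltW.
have ev : v * expR (- (c / 2 * v)) <= 2 / c.
  rewrite expRN ler_pdivrMr ?expR_gt0//.
  have := expR_ge1Dx (c / 2 * v) => h.
  apply: (@le_trans _ _ (2 / c * (c / 2 * v))).
    by rewrite mulrA (_ : 2 / c * (c / 2) = 1) ?mul1r//; field; lra.
  by apply: ler_wpM2l; [rewrite divr_ge0// ltW|lra].
apply: (@le_trans _ _ ((`|P.[v]| * v + `|a|) * expR (- (c * v)))).
  apply: ler_wpM2r; first exact: expR_ge0.
  by apply: le_trans (ler_normD _ _) _; rewrite normrM (gtr0_norm v0).
rewrite mulrDl; apply: lerD; last by rewrite ler_piMr.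
have -> : expR (- (c * v)) = expR (- (c / 2 * v)) * expR (- (c / 2 * v)).
  by rewrite -expRD; congr expR; field.
rewrite mulrACA; apply: ler_pM; [| |exact: PC|exact: ev].
  by apply: mulr_ge0; rewrite ?expR_ge0.
by apply: mulr_ge0; rewrite ?expR_ge0// ltW.
Qed.

(** The classical function that is flat at [0], multiplied by a polynomial in
    [1 / u]: this family is stable under differentiation, and the rate [c]
    makes the function approach [1] on positive numbers as [c] tends to [0]. *)
Definition flat c P u := if 0 < u then P.[u^-1] * expR (- c * u^-1) else 0.

(** The derivative only changes the polynomial factor. *)
Definition flat_step c P := 'X^2 * (c *: P - P^`()).

Lemma flat_bounded P c : 0 < c -> exists2 C, 0 <= C & forall u, `|flat c P u| <= C.
Proof.
move=> c0; have [C C0 PC] := poly_expR_bounded P c0; exists C => // u.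
rewrite /flat; case: ifPn => [u0|_]; last by rewrite normr0.
by rewrite normrM (ger0_norm (expR_ge0 _)) mulNr PC// invr_gt0.
Qed.

Lemma flat_quadratic P c : 0 < c ->
  exists2 C, 0 <= C & forall u, `|flat c P u| <= C * u ^+ 2.
Proof.
move=> c0; have [C C0 PC] := flat_bounded ('X^2 * P) c0; exists C => // u.
have := PC u; rewrite /flat; case: ifPn => [u0|_ _]; last first.
  by rewrite normr0 mulr_ge0// sqr_ge0.
rewrite hornerM hornerXn -mulrA normrM normrX (gtr0_norm (_ : 0 < u^-1)) ?invr_gt0//.
by rewrite exprVn ler_pdivrMl ?exprn_gt0// [C * _]mulrC.
Qed.

(** At [0] both one-sided difference quotients tend to [0] because the
    function is bounded by a multiple of the square of its argument. *)
Lemma is_derive_flat c P u : 0 < c ->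
  is_derive u 1 (flat c P) (flat c (flat_step c P) u).
Proof.
move=> c0; have [u0|u0|u0] := ltgtP u 0.
- have -> : flat c (flat_step c P) u = 0 by rewrite /flat ltNge ltW.
  apply: (@near_eq_is_derive _ _ _ (cst 0)).
  near=> v; rewrite /flat ifF//; apply/negbTE; rewrite -leNgt ltW//.
  near: v; exact: lt_nbhsl.
- pose f (v : R) : R := P.[v^-1] * expR (- c * v^-1).
  apply: (@near_eq_is_derive _ _ _ f).
    near=> v; rewrite /flat ifT//; near: v; exact: lt_nbhsr.
  rewrite /flat u0.
  have un0 : u != 0 by rewrite gt_eqF.
  have dV : is_derive u 1 (fun v : R => v^-1) (- u ^- 2).
    rewrite -[- u ^- 2]mulr1.
    exact: (@is_deriveV _ id u 1 1 un0 (is_derive_id u 1)).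
  have dg : is_derive u 1 (fun v : R => - c * v^-1) (- c * - u ^- 2).
    exact: (is_deriveZ (- c) dV).
  have dP : is_derive u 1 (fun v : R => P.[v^-1]) (P^`().[u^-1] * - u ^- 2).
    exact: (@is_derive1_comp _ (horner P) _ u _ _ _ dV).
  have dE : is_derive u 1 (fun v : R => expR (- c * v^-1))
      (expR (- c * u^-1) * (- c * - u ^- 2)).
    exact: (@is_derive1_comp _ expR _ u _ _ _ dg).
  apply: (is_derive_eq (is_deriveM dP dE)).
  rewrite /flat_step !hornerE /= /GRing.scale/= exprVn; ring.
- rewrite u0 [X in is_derive _ _ _ X]/flat ltxx.
  have [C C0 PC] := flat_quadratic P c0.
  have lim0 : h^-1 *: ((flat c P \o shift 0) (h *: 1) - flat c P 0)
      @[h --> 0^'] --> (0 : R).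
    apply/cvgr0Pnorm_le => e e0; near=> h.
    have h0 : h != 0 by near: h; exact: nbhs_dnbhs_neq.
    rewrite /= addr0 /GRing.scale/= mulr1 [flat c P 0]/flat ltxx subr0.
    rewrite normrM normfV ler_pdivrMl ?normr_gt0//.
    apply: le_trans (PC h) _; rewrite -(real_normK (num_real h)) expr2 mulrCA.
    apply: ler_wpM2l => //.
    have : `|h| <= e / (C + 1).
      near: h; apply: nbhs_dnbhs.
      by apply: (@nbhs0_le _ R^o); rewrite divr_gt0// ltr_pwDr.
    rewrite ler_pdivlMr ?ltr_pwDr// mulrDr mulr1 [C * _]mulrC.
    by apply: le_trans; rewrite lerDl.
  apply: DeriveDef; first by apply/cvg_ex; exists 0.
  by apply: cvg_lim.
Unshelve. all: by end_near. Qed.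

End FlatFunction.

Section AffineFlat.
Variable R : realType.
Implicit Types (c x y t alpha beta : R) (P : {poly R}).

Lemma is_derive_flat_affine c P alpha beta t : 0 < c ->
  is_derive t 1 (fun t => flat c P (alpha * t + beta))
    (alpha * flat c (flat_step c P) (alpha * t + beta)).
Proof.
move=> c0.
have da : is_derive t 1 (fun t => alpha * t + beta) alpha.
  have := is_deriveD (is_deriveZ alpha (is_derive_id t 1)) (is_derive_cst beta t 1).
  by rewrite addr0 /GRing.scale/= mulr1.
have df := is_derive_flat P (alpha * t + beta) c0.
by rewrite mulrC; exact: (@is_derive1_comp _ (flat c P) _ t _ _ df da).
Qed.

Lemma flatZ c P alpha u : flat c (alpha *: P) u = alpha * flat c P u.
Proof. by rewrite /flat; case: ifP; rewrite ?mulr0// hornerZ mulrA. Qed.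

Lemma smooth_flat_affine c P alpha beta : 0 < c ->
  smooth (fun t => flat c P (alpha * t + beta)).
Proof.
move=> c0 n; elim: n P => [|n IH] P.
  by split=> // t; case: (is_derive_flat_affine P alpha beta t c0).
split; first by move=> t; case: (is_derive_flat_affine P alpha beta t c0).
rewrite (_ : derive1 _ =
    (fun t => flat c (alpha *: flat_step c P) (alpha * t + beta))); first exact: IH.
apply/funext => t; rewrite derive1E flatZ.
by case: (is_derive_flat_affine P alpha beta t c0).
Qed.

Lemma flat1_ge0 c u : 0 <= flat c 1 u.
Proof. by rewrite /flat; case: ifP => // _; rewrite hornerC mul1r expR_ge0. Qed.

Lemma flat1_le1 c u : 0 < c -> flat c 1 u <= 1.
Proof.
move=> c0; rewrite /flat; case: ifP => // u0; rewrite hornerC mul1r.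
by rewrite -[leRHS]expR0 ler_expR mulNr oppr_le0 divr_ge0 ?ltW.
Qed.

Lemma flat_le0 c P u : u <= 0 -> flat c P u = 0.
Proof. by rewrite /flat leNgt => /negbTE ->. Qed.

Lemma flat1_gt0 c u : 0 < u -> flat c 1 u = expR (- c * u^-1).
Proof. by rewrite /flat => ->; rewrite hornerC mul1r. Qed.

Lemma flat_step1_ge0 c u : 0 < c -> 0 <= flat c (flat_step c 1) u.
Proof.
move=> c0; rewrite /flat; case: ifP => // u0; rewrite mulr_ge0 ?expR_ge0//.
rewrite /flat_step derivC subr0 hornerM hornerXn hornerZ hornerC.
by rewrite mulr_ge0 ?sqr_ge0// mulr1 ltW.
Qed.

End AffineFlat.

Section Bump.
Variables (R : realType) (c x y : R).
Hypothesis c0 : 0 < c.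

Let A (t : R) : R := flat c 1 (1 * t + - x).
Let B (t : R) : R := flat c 1 (- 1 * t + y).
Let A' (t : R) : R := 1 * flat c (flat_step c 1) (1 * t + - x).
Let B' (t : R) : R := - 1 * flat c (flat_step c 1) (- 1 * t + y).

(** Smooth approximation of the indicator of the interval from [x] to [y], as
    a product of a nondecreasing and a nonincreasing factor. *)
Definition bump : R -> R := A * B.

Let dA (t : R) : is_derive t 1 A (A' t). Proof. exact: is_derive_flat_affine. Qed.
Let dB (t : R) : is_derive t 1 B (B' t). Proof. exact: is_derive_flat_affine. Qed.

Let bump' (t : R) : R := A t * B' t + B t * A' t.

Lemma is_derive_bump (t : R) : is_derive t 1 bump (bump' t).
Proof. exact: (is_deriveM (dA t) (dB t)). Qed.

Lemma derive1_bump t : derive1 bump t = bump' t.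
Proof. by rewrite derive1E; case: (is_derive_bump t). Qed.

Lemma smooth_bump : smooth bump.
Proof. by apply: smoothM; exact: smooth_flat_affine. Qed.

Lemma bump_ge0 t : 0 <= bump t.
Proof. by rewrite mulr_ge0 ?flat1_ge0. Qed.

Lemma bump_out t : t <= x \/ y <= t -> bump t = 0.
Proof.
case=> h; rewrite -[bump t]/(A t * B t).
  by rewrite /A flat_le0 ?mul0r//; lra.
by rewrite /B flat_le0 ?mulr0//; lra.
Qed.

Let A'_ge0 t : 0 <= A' t. Proof. by rewrite /A' mul1r flat_step1_ge0. Qed.
Let B'_le0 t : B' t <= 0.
Proof. by rewrite /B' mulN1r oppr_le0 flat_step1_ge0. Qed.

Lemma test_function_bump a b : a < x -> y < b -> test_function a b bump.
Proof.
move=> ax yb.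
have sub : closure [set t | bump t != 0] `<=` `[x, y].
  rewrite (closure_id `[x, y]%classic).1; last exact: itv_closed.
  apply: closureS => t /= bt; rewrite in_itv/= leNgt [t <= y]leNgt.
  apply/andP; split; apply/negP => h; move/eqP: bt; apply; apply: bump_out.
    by left; exact: ltW.
  by right; exact: ltW.
split.
- by move=> n t; apply: smooth_derive1n; exact: smooth_bump.
- apply: (@subclosed_compact _ _ `[x, y]) => //; first exact: closed_closure.
  exact: segment_compact.
- by move=> t /sub /=; rewrite !in_itv/=; lra.
Qed.

(** The derivative of [bump] is a nonnegative function times [B] plus [A]
    times a nonpositive one. Replacing the monotone [g] by [g x] costs
    nothing in the first term, and at most [(g y - g x) * - B' t] in
    the second as [A <= 1]. *)
Let bump_pointwise (g : R -> R) (a b t : R) : a < x -> y < b -> x < y ->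
  (forall s u, a < s -> s <= u -> u < b -> g s <= g u) ->
  - (g t * bump' t) <= - g x * bump' t + (g y - g x) * - B' t.
Proof.
move=> ax yb xy g_nd.
have gxy : 0 <= g y - g x by rewrite subr_ge0 g_nd//; lra.
have [xt|tx] := leP x t; last first.
  have A0 : A t = 0 by apply: flat_le0; lra.
  have A'0 : A' t = 0 by rewrite /A' flat_le0 ?mulr0//; lra.
  rewrite /bump' A0 A'0 mul0r mulr0 addr0 !mulr0 oppr0 add0r.
  by rewrite mulr_ge0// oppr_ge0.
have [ty|yt] := leP t y; last first.
  have B0 : B t = 0 by apply: flat_le0; lra.
  have B'0 : B' t = 0 by rewrite /B' flat_le0 ?mulr0//; lra.
  by rewrite /bump' B0 B'0 mul0r mulr0 addr0 !mulr0 oppr0 mulr0 addr0.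
have g1 : g x <= g t by apply: g_nd; lra.
have g2 : g t <= g y by apply: g_nd; lra.
have A0 : 0 <= A t := flat1_ge0 _ _.
have A1 : A t <= 1 := flat1_le1 _ c0.
have B0 : 0 <= B t := flat1_ge0 _ _.
have := A'_ge0 t; have := B'_le0 t; rewrite /bump'.
move: (A t) (B t) (A' t) (B' t) A0 A1 B0 => p q p' q' p0 p1 q0 q'0 p'0.
have e1 : 0 <= (g t - g x) * (q * p') by rewrite !mulr_ge0// subr_ge0.
have e2 : (g t - g x) * (p * - q') <= (g y - g x) * (1 * - q').
  apply: ler_pM; rewrite ?subr_ge0//.
  - by rewrite mulr_ge0// oppr_ge0.
  - by rewrite lerB.
  - by rewrite ler_wpM2r// oppr_ge0.
by lra.
Qed.

Let cflat P (alpha beta : R) : continuous (fun t : R => flat c P (alpha * t + beta) : R).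
Proof.
move=> t; apply/differentiable_continuous/derivable1_diffP.
by case: (is_derive_flat_affine P alpha beta t c0).
Qed.

Let cA : continuous A. Proof. exact: cflat. Qed.
Let cB : continuous B. Proof. exact: cflat. Qed.
Let cA' : continuous A'.
Proof. by move=> t; apply: cvgM; [exact: cvg_cst|exact: cflat]. Qed.
Let cB' : continuous B'.
Proof. by move=> t; apply: cvgM; [exact: cvg_cst|exact: cflat]. Qed.
Let cbump' : continuous bump'.
Proof.
move=> t; apply: cvgD; apply: cvgM;
  [exact: cA|exact: cB'|exact: cB|exact: cA'].
Qed.

Let bump'_bounded : exists2 C, 0 <= C & forall t, `|bump' t| <= C.
Proof.
have [C C0 PC] := flat_bounded (flat_step c 1) c0.
exists (C + C); first by rewrite addr_ge0.
move=> t; have A0 : 0 <= A t := flat1_ge0 _ _.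
have A1 : A t <= 1 := flat1_le1 _ c0.
have B0 : 0 <= B t := flat1_ge0 _ _.
have B1 : B t <= 1 := flat1_le1 _ c0.
apply: le_trans (ler_normD _ _) _; rewrite !normrM (ger0_norm A0) (ger0_norm B0).
rewrite normrN1 normr1 !mul1r.
by apply: lerD; rewrite -[leRHS]mul1r; apply: ler_pM.
Qed.

Let bump'_out t : t <= x \/ y <= t -> bump' t = 0.
Proof.
case=> h; rewrite /bump'.
  have A0 : A t = 0 by apply: flat_le0; lra.
  have A'0 : A' t = 0 by rewrite /A' flat_le0 ?mulr0//; lra.
  by rewrite A0 A'0 mul0r mulr0 addr0.
have B0 : B t = 0 by apply: flat_le0; lra.
have B'0 : B' t = 0 by rewrite /B' flat_le0 ?mulr0//; lra.
by rewrite B0 B'0 mul0r mulr0 addr0.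
Qed.

(** The pointwise bound integrates explicitly: the derivative of [bump] has
    integral [0], and that of [- B] has integral at most [1]. *)
Lemma integral_bump_le (g : R -> R) (a b : R) : a < x -> x < y -> y < b ->
  (forall s u, a < s -> s <= u -> u < b -> g s <= g u) ->
  (- (\int[lebesgue_measure]_(t in `]a, b[) (g t * derive1 bump t)%:E)
    <= (g y - g x)%:E)%E.
Proof.
move=> ax xy yb g_nd; set mu := lebesgue_measure.
have ab : a < b by lra.
have gxy : 0 <= g y - g x by rewrite subr_ge0 g_nd//; lra.
have mab : measurable (`]a, b[ : set R) by exact: measurable_itv.
have muab : (mu `]a, b[%classic < +oo)%E by rewrite /mu lebesgue_measure_itv/= lte_fin ab ltry.
(* Only the values of [g] between [x] and [y] matter; clamping the argument gives
   a function that is monotone on the whole line, hence measurable. *)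
pose G t := g (Num.max x (Num.min t y)).
have G_nd : nondecreasing_fun G.
  move=> s t st; apply: g_nd.
  - by rewrite lt_max ax.
  - by rewrite ge_max !le_max lexx/= le_min !ge_min st lexx !orbT.
  - by rewrite gt_max gt_min yb orbT andbT; lra.
have GE t : g t * derive1 bump t = G t * bump' t.
  rewrite derive1_bump; have [tx|xt] := leP t x; first by rewrite bump'_out ?mulr0//; left.
  have [yt|ty] := leP y t; first by rewrite bump'_out ?mulr0//; right.
  by rewrite /G min_l ?max_r// ltW.
under eq_integral do rewrite GE.
pose S (t : R) : R := - g x * bump' t + (g y - g x) * - B' t.
have cS : continuous S.
  move=> t; apply: cvgD; apply: cvgM; [exact: cvg_cst|exact: cbump'|exact: cvg_cst|].
  by apply: cvgN; exact: cB'.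
have iS : mu.-integrable `]a, b[ (EFin \o S).
  apply: (@integrableS _ _ _ mu `[a, b]) => //.
    exact: subset_itv_oo_cc.
  apply: continuous_compact_integrable; first exact: segment_compact.
  exact: continuous_subspaceT.
have iF : mu.-integrable `]a, b[ (EFin \o (fun t => G t * bump' t)).
  apply: measurable_bounded_integrable => //.
    apply: measurable_funM; first exact: nondecreasing_measurable.
    by apply: measurable_funTS; exact: continuous_measurable_fun.
  have [C C0 bC] := bump'_bounded.
  exists ((`|g x| + `|g y|) * C); split; first exact: num_real.
  move=> M CM t _ /=; apply: le_trans (ltW CM); rewrite normrM.
  apply: ler_pM => //.
  have : g x <= G t.
    by apply: g_nd => //; [rewrite le_max lexx|rewrite gt_max gt_min yb orbT andbT; lra].
  have : G t <= g y.
    apply: g_nd; [by rewrite lt_max ax| |by []].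
    by rewrite ge_max ge_min lexx orbT andbT ltW.
  have := ler_norm (g y); have := ler_norm (- g x); rewrite normrN ler_norml.
  by have := normr_ge0 (g x); have := normr_ge0 (g y); lra.
have SE : ((\int[mu]_(t in `]a, b[) (S t)%:E) <= (g y - g x)%:E)%E.
  pose Phi (t : R) : R := - g x * bump t - (g y - g x) * B t.
  have dPhi (t : R) : is_derive t 1 Phi (S t).
    have := is_deriveB (is_deriveZ (- g x) (is_derive_bump t))
      (is_deriveZ (g y - g x) (dB t)).
    rewrite /S mulrN; exact.
  rewrite -(@integral_itv_bndoo _ _ _ _ true false); last first.
    by case/integrableP: iS.
  rewrite (@continuous_FTC2 _ S Phi a b)//.
  - rewrite -EFinB lee_fin /Phi.
    rewrite (@bump_out b) ?(@bump_out a); [|by left; lra|by right; lra].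
    have -> : B b = 0 by apply: flat_le0; lra.
    have B1 : B a <= 1 := flat1_le1 _ c0.
    by have := ler_piMr gxy B1; lra.
  - exact: continuous_subspaceT.
  - split; first by move=> t _; case: (dPhi t).
    + apply: cvg_at_right_filter.
      by apply/differentiable_continuous/derivable1_diffP; case: (dPhi a).
    + apply: cvg_at_left_filter.
      by apply/differentiable_continuous/derivable1_diffP; case: (dPhi b).
  - by move=> t _; rewrite derive1E; case: (dPhi t).
apply: le_trans SE; rewrite -integralN/=; last exact: integrable_add_def.
apply: le_integral => //; first exact: (integrableN iF).
move=> t _; have := bump_pointwise t ax yb xy g_nd.
by rewrite -{1}derive1_bump GE => h; rewrite lee_fin; exact: h.
Qed.

End Bump.

(** * Increments of the right derivative *)

Section SecondDerivative.
Variables (R : realType) (a b : R) (g : R -> R).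
Variable mu : {finite_measure set (measurableTypeR R) -> \bar R}.
Hypothesis g_nd : forall s u, a < s -> s <= u -> u < b -> g s <= g u.
Hypothesis g_mu : distributional_derivative a b g mu.

Let nu := @lebesgue_measure R.

Lemma bump_lower (c x y x' y' t : R) : 0 < c -> x < x' -> y' < y ->
  x' <= t -> t <= y' ->
  1 - c * ((x' - x)^-1 + (y - y')^-1) <= bump c x y t.
Proof.
move=> c0 xx' y'y x't ty'.
rewrite -[bump c x y t]/(flat c 1 (1 * t + - x) * flat c 1 (- 1 * t + y)).
rewrite mul1r mulN1r !flat1_gt0; [|lra|lra].
rewrite -expRD; apply: le_trans (expR_ge1Dx _).
rewrite lerD2l -mulrDr mulNr lerN2 ler_wpM2l ?(ltW c0)//.
by apply: lerD; rewrite lef_pV2 ?posrE; lra.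
Qed.

(** Test the distributional identity against [bump c x y] and let [c] tend
    to [0]. *)
Lemma D2_itv_le x x' y' y : a < x -> x < x' -> x' <= y' -> y' < y -> y < b ->
  (mu `[x', y']%classic <= (g y - g x)%:E)%E.
Proof.
move=> ax xx' xy' y'y yb.
have xy : x < y by lra.
have mab : measurable (`]a, b[%classic : set (measurableTypeR R)).
  exact: measurable_itv.
have mI : measurable (`[x', y']%classic : set (measurableTypeR R)).
  exact: measurable_itv.
have fI : mu `[x', y']%classic \is a fin_num by exact: fin_num_measure.
set K := (x' - x)^-1 + (y - y')^-1.
have K0 : 0 < K by rewrite addr_gt0// invr_gt0 subr_gt0.
pose M := fine (mu `[x', y']%classic).
have M0 : 0 <= M by rewrite fine_ge0.
have ME : mu `[x', y']%classic = M%:E by rewrite fineK.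
have key c : 0 < c -> c * K <= 1 -> (1 - c * K) * M <= g y - g x.
  move=> c0 cK; rewrite -lee_fin.
  have := integral_bump_le c0 ax xy yb g_nd.
  rewrite -(g_mu (test_function_bump c0 ax yb)); apply: le_trans.
  have mbump D : measurable D -> measurable_fun D (EFin \o bump c x y).
    move=> mD; apply/measurable_EFinP; apply: measurable_funTS.
    apply: continuous_measurable_fun => t.
    by apply/differentiable_continuous/derivable1_diffP/smooth_derivable/smooth_bump.
  apply: (@le_trans _ _ (\int[mu]_(t in `[x', y']) (bump c x y t)%:E)%E); last first.
    apply: ge0_subset_integral => //.
    - exact: mbump.
    - by move=> t _; rewrite lee_fin bump_ge0.
    - by move=> t/=; rewrite !in_itv/=; lra.
  rewrite EFinM -ME -integral_cst//; apply: ge0_le_integral => //.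
  - by move=> t _; rewrite lee_fin; lra.
  - exact: mbump.
  - by move=> t/=; rewrite in_itv/= lee_fin => /andP[t1 t2]; exact: bump_lower.
rewrite ME lee_fin; apply/ler_addgt0Pr => e e0.
(* This rate [c] turns the loss [c * K * M] into at most [e]. *)
have MK : 0 < (M + e) * K by rewrite mulr_gt0// ltr_wpDl.
have c0 : 0 < e / ((M + e) * K) by rewrite divr_gt0.
have cK : e / ((M + e) * K) * K = e / (M + e).
  by field; rewrite !gt_eqF//; lra.
have eM : e / (M + e) <= 1 by rewrite ler_pdivrMr; lra.
have := key _ c0; rewrite cK => /(_ eM).
have : e / (M + e) * M <= e by rewrite mulrAC ler_pdivrMr ?ler_wpM2l; lra.
lra.
Qed.

Variables (B : set (measurableTypeR R)) (c : R).
Hypothesis mB : measurable B.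
Hypothesis c0 : 0 < c.
Hypothesis B_mu : forall A : set (measurableTypeR R), measurable A ->
  A `<=` `]a, b[ -> (c%:E * nu (A `&` B) <= mu A)%E.

(** A density bound for the second derivative on [B] becomes a growth bound
    for the first derivative; the closed interval inside is stretched to the
    whole interval at a cost of [d] at each end. *)
Lemma D2_lower_bound x y : a < x -> x < y -> y < b ->
  c * fine (nu (B `&` `]x, y])) <= g y - g x.
Proof.
move=> ax xy yb; apply/ler_addgt0Pr => e e0.
have D0 : 0 <= g y - g x by rewrite subr_ge0 g_nd//; lra.
pose d := Num.min (e / (2 * c)) ((y - x) / 2).
have d0 : 0 < d.
  by rewrite lt_min !divr_gt0//; [lra|rewrite mulr_gt0].
have dxy : d <= (y - x) / 2 by rewrite ge_min lexx orbT.
have de : c * (d + d) <= e.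
  have : d <= e / (2 * c) by rewrite ge_min lexx.
  by rewrite ler_pdivlMr ?mulr_gt0//; lra.
have fin_sub (A : set (measurableTypeR R)) : measurable A ->
    A `<=` `[x, y] -> nu A \is a fin_num.
  move=> mA sA; rewrite ge0_fin_numE//.
  apply: (@le_lt_trans _ _ (nu `[x, y]%classic)).
    by apply: le_measure; rewrite ?inE//; exact: measurable_itv.
  by rewrite /nu lebesgue_measure_itv/= lte_fin xy -EFinB ltry.
have fB : nu (B `&` `]x, y]) \is a fin_num.
  apply: fin_sub; first by apply: measurableI => //; exact: measurable_itv.
  by move=> t [_ /=]; rewrite !in_itv/= => /andP[/ltW-> ->].
have := @D2_itv_le x (x + d) (y - d) y; rewrite ax yb.
move=> /(_ isT ltac:(lra) ltac:(lra) ltac:(lra) isT) h.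
have mI : measurable (`[x + d, y - d]%classic : set (measurableTypeR R)).
  exact: measurable_itv.
have sI : `[x + d, y - d]%classic `<=` `]a, b[.
  by move=> t/=; rewrite !in_itv/=; lra.
have := le_trans (B_mu mI sI) h.
have sub : B `&` `]x, y] `<=` (`[x + d, y - d]%classic `&` B) `|`
   (`[x, x + d]%classic `|` `[y - d, y]%classic).
  move=> t [Bt]/=; rewrite !in_itv/= => /andP[xt ty].
  have [t1|t1] := leP t (x + d); first by right; left; rewrite ltW.
  have [t2|t2] := leP (y - d) t; first by right; right; rewrite /= ty.
  by left; rewrite !ltW.
have nI : nu (`[x + d, y - d]%classic `&` B) \is a fin_num.
  apply: fin_sub; first exact: measurableI.
  by move=> t [/=]; rewrite !in_itv/=; lra.
have : (nu (B `&` `]x, y]) <=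
    nu (`[x + d, y - d]%classic `&` B)%R + (d%:E + d%:E))%E.
  apply: le_trans (le_measure _ _ _ sub) _; rewrite ?inE.
  - by apply: measurableI => //; exact: measurable_itv.
  - by apply: measurableU; [exact: measurableI|apply: measurableU; exact: measurable_itv].
  apply: le_trans (measureU2 _ _ _) _ => //.
  - exact: measurableI.
  - by apply: measurableU; exact: measurable_itv.
  apply: leeD2l; apply: le_trans (measureU2 _ _ _) _; try exact: measurable_itv.
  have l1 : nu `[x, x + d]%classic = d%:E.
    by rewrite /nu lebesgue_measure_itv/= lte_fin ltrDl d0 -EFinB addrAC subrr add0r.
  have l2 : nu `[y - d, y]%classic = d%:E.
    by rewrite /nu lebesgue_measure_itv/= lte_fin gtrBl d0 -EFinB opprB addrC subrK.
  by rewrite -{1}l1 -l2; exact: lexx.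
rewrite -(fineK fB) -(fineK nI) -!EFinD -EFinM !lee_fin => h1 h2.
have := ler_wpM2l (ltW c0) h1.
by rewrite mulrDr; lra.
Qed.

End SecondDerivative.

(** * Uniform density points *)

Section Density.
Variable R : realType.
Local Notation nu := (@lebesgue_measure R).

(** The positivity set is a countable union of superlevel sets. *)
Lemma superlevel_set_gt0 (D : set (measurableTypeR R)) (k : R -> R) :
  measurable D -> measurable_fun D k ->
  (0 < nu (D `&` [set x | (0 < k x)%R]))%E ->
  exists2 c : R, 0 < c & (0 < nu (D `&` [set x | (c <= k x)%R]))%E.
Proof.
move=> mD mk; apply: contraPP => /forall2NP H.
have mE c : measurable (D `&` [set x | (c <= k x)%R]).
  rewrite (_ : [set x | _] = k @^-1` `[c, +oo[).
    by apply: mk => //; exact: measurable_itv.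
  by apply/seteqP; split => x /=; rewrite in_itv/= andbT.
have -> : D `&` [set x | (0 < k x)%R] =
    \bigcup_n (D `&` [set x | (n.+1%:R^-1 <= k x)%R]).
  apply/seteqP; split => [x [Dx /= kx]|x [n _ [Dx /= nk]]].
    have [n nk] := ltr_add_invr kx.
    by exists n => //; split => //=; rewrite add0r in nk; exact: ltW.
  by split => //=; apply: lt_le_trans nk; rewrite invr_gt0.
apply/negP; rewrite -leNgt.
apply: le_trans (measure_sigma_subadditive _ _ _ (@subset_refl _ _)) _ => //.
  exact: bigcup_measurable.
rewrite eseries0// => n _ _; apply/eqP; rewrite -measure_le0 leNgt.
by have [] := H n.+1%:R^-1; [rewrite invr_gt0|move/negP].
Qed.

Variables (a b : R) (B : set (measurableTypeR R)).
Hypothesis mB : measurable B.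
Hypothesis Bab : B `<=` `]a, b[.

Let fin_sub (A : set (measurableTypeR R)) : measurable A -> A `<=` `[a, b] ->
  nu A \is a fin_num.
Proof.
move=> mA sA; rewrite ge0_fin_numE//.
apply: (@le_lt_trans _ _ (nu `[a, b]%classic)).
  by apply: le_measure; rewrite ?inE//; exact: measurable_itv.
by rewrite lebesgue_measure_itv/=; case: ifP => // _; rewrite -EFinB ltry.
Qed.

Let F x := fine (nu (B `&` `]a, x])).

Let mBI (i : interval R) : measurable (B `&` [set` i] : set (measurableTypeR R)).
Proof. by apply: measurableI => //; exact: measurable_itv. Qed.

Let fBI (i : interval R) : nu (B `&` [set` i]) \is a fin_num.
Proof. by apply: fin_sub => // x [/Bab/= + _]; exact: subset_itv_oo_cc. Qed.

Let FB x y : a <= x -> x <= y -> F y - F x = fine (nu (B `&` `]x, y])).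
Proof.
move=> ax xy; rewrite /F.
have -> : B `&` `]a, y] = (B `&` `]a, x]) `|` (B `&` `]x, y]).
  rewrite -setIUr; congr (_ `&` _); apply/seteqP; split => z/=; rewrite !in_itv/=.
    move=> /andP[az zy]; have [zx|xz] := leP z x; [left|right];
      by rewrite ?az ?zx ?xz ?zy.
  move=> [/andP[az zx]|/andP[xz zy]]; apply/andP; lra.
rewrite measureU//; last first.
  apply/seteqP; split => // z [[_ /= h1] [_ /= h2]].
  by move: h1 h2; rewrite !in_itv/=; lra.
rewrite fineD ?fBI//. by rewrite addrAC subrr add0r.
Qed.

Let F_nd x y : a <= x -> x <= y -> F x <= F y.
Proof. by move=> ax xy; rewrite -subr_ge0 FB// fine_ge0. Qed.

Let F_lip x y : a <= x -> x <= y -> F y - F x <= y - x.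
Proof.
move=> ax; rewrite le_eqVlt => /predU1P[->|xy]; first by rewrite !subrr.
rewrite FB ?(ltW xy)// -lee_fin fineK//.
apply: (@le_trans _ _ (nu `]x, y]%classic)).
  by apply: le_measure; rewrite ?inE//; exact: measurable_itv.
by rewrite lebesgue_measure_itv/= lte_fin xy EFinB.
Qed.

(** Points whose right neighbourhoods meet [B] in a proportion at least
    [1 / (m + 1)], at all scales. The conditions are closed because [F] is
    continuous, which makes [K m] compact. *)
Let K m : set R :=
  `[a + m.+1%:R^-1, b - m.+1%:R^-1] `&`
  [set x | forall y, x < y -> y < b -> (y - x) / m.+1%:R <= F y - F x].

Let compact_K m : compact (K m : set R).
Proof.
pose d : R := m.+1%:R^-1.
have d0 : 0 < d by rewrite invr_gt0.
have clK (x : R) : closure (K m) x -> K m x.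
  move=> Kx.
  have near_K e : 0 < e -> exists2 z, K m z & `|x - z| < e.
    by move=> e0; have [z [Kz xz]] := Kx _ (nbhsx_ballx x e e0); exists z.
  have [xl xr] : a + d <= x /\ x <= b - d.
    split.
      have [//|h] := leP (a + d) x.
      have e0 : 0 < a + d - x by lra.
      have [z [/= + _]] := near_K _ e0.
      by rewrite -/d in_itv/= ltr_norml; lra.
    have [//|h] := leP x (b - d).
    have e0 : 0 < x - (b - d) by lra.
    have [z [/= + _]] := near_K _ e0.
    by rewrite -/d in_itv/= ltr_norml; lra.
  split; first by rewrite /= -/d in_itv/= xl xr.
  move=> y xy yb; rewrite -/d; apply/ler_addgt0Pr => e e0.
  have r0 : 0 < Num.min (e / 2) (y - x) by rewrite lt_min divr_gt0// subr_gt0.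
  have [z [/=]] := near_K _ r0; rewrite -/d in_itv/= => /andP[zl zr] Kz.
  rewrite lt_min !ltr_norml => /andP[/andP[z1 z2] /andP[z3 z4]].
  have zy : z < y by lra.
  have := Kz _ zy yb.
  have : (y - x) * d - e / 2 <= (y - z) * d.
    have -> : (y - z) * d = (y - x) * d + (x - z) * d by ring.
    rewrite lerD2l lerNl -mulNr; apply: (@le_trans _ _ (e / 2 * d)).
      by apply: ler_wpM2r; lra.
    by rewrite ler_piMr ?invf_le1 ?ler1n// divr_ge0// ltW.
  have : F x - F z <= e / 2.
    have [xz|/ltW zx] := leP x z.
      by have := F_nd (ltac:(lra) : a <= x) xz; lra.
    by have := F_lip (ltac:(lra) : a <= z) zx; lra.
  lra.
apply: (@subclosed_compact R _ (`[a + d, b - d]%classic : set R)).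
- exact: clK.
- exact: segment_compact.
- by move=> x [].
Qed.

Let mK m : measurable (K m : set (measurableTypeR R)).
Proof. exact: compact_measurable. Qed.

Let density_in_K (x : R) : B x -> (nu (B `&` ball x r) * (nu (ball x r))^-1)%E
    @[r --> 0^'+] --> (\1_B x : R)%:E -> exists m, K m x.
Proof.
move=> Bx; rewrite indicE mem_set//= => /fine_cvgP[_ lim1].
have /= := Bab Bx; rewrite in_itv/= => /andP[ax xb].
have [r [r0 rb rP]] : exists r, [/\ 0 < r, x + r < b &
    forall y, x < y -> y <= x + r -> (y - x) / 2 <= F y - F x].
  (* If [B] fills three quarters of a centred interval of radius [h], then it
     fills at least half of its right half. *)
  have /cvgrPdist_le/(_ (1 / 4) ltac:(lra)) : fine (nu (B `&` ball x r) * (nu (ball x r))^-1)%E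
    @[r --> 0^'+] --> (1 : R) by exact: lim1.
  case=> r /= r0 rP; pose r' := Num.min (r / 2) ((b - x) / 2).
  have r'0 : 0 < r' by rewrite lt_min !divr_gt0// subr_gt0.
  have r'1 : r' <= r / 2 by rewrite ge_min lexx.
  have r'2 : r' <= (b - x) / 2 by rewrite ge_min lexx orbT.
  exists r'; split => //; first by lra.
  move=> y xy yr; pose h := y - x.
  have h0 : 0 < h by rewrite subr_gt0.
  have := rP h; rewrite /ball_/= sub0r normrN gtr0_norm//.
  move=> /(_ ltac:(rewrite /h; lra) h0).
  rewrite lebesgue_measure_ball ?(ltW h0)//.
  have fB : nu (B `&` ball x h) \is a fin_num.
    apply: fin_sub.
      by apply: measurableI => //; exact: measurable_ball.
    by move=> z [/Bab/= + _]; exact: subset_itv_oo_cc.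
  rewrite -(fineK fB) inver gt_eqF ?mulrn_wgt0// -EFinM/= ler_norml => /andP[_].
  rewrite lerBlDl -lerBlDr ler_pdivlMr ?mulrn_wgt0// => l1.
  have mxx : measurable (`]x - h, x]%classic : set (measurableTypeR R)).
    exact: measurable_itv.
  have l2 : (nu (B `&` ball x h) <= h%:E + nu (B `&` `]x, y]))%E.
    have sub : B `&` ball x h `<=` `]x - h, x]%classic `|` (B `&` `]x, y]).
      move=> z [Bz]; rewrite ball_itv/= !in_itv/= => /andP[z1 z2].
      have [zx|xz] := leP z x; first by left; rewrite z1.
      by right; split => //=; rewrite /h in z2; lra.
    apply: le_trans (le_measure _ _ _ sub) _; rewrite ?inE.
    - by apply: measurableI => //; exact: measurable_ball.
    - exact: measurableU.
    apply: le_trans (measureU2 _ mxx (mBI _)) _.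
    have nxx : nu `]x - h, x]%classic = h%:E.
      by rewrite lebesgue_measure_itv/= lte_fin gtrBl h0 -EFinB opprB addrC subrK.
    by rewrite -nxx; exact: lexx.
  rewrite FB ?(ltW ax) ?(ltW xy)//.
  move: l2; rewrite -(fineK fB) -(fineK (fBI _)) -EFinD lee_fin -/h; lra.
(* Scales beyond [r] are controlled by the scale [r], at the price of the factor
   [r / (b - a)]. *)
pose e := Num.min (Num.min 2^-1 (r / (2 * (b - a)))) (Num.min (x - a) (b - x)).
have ba : 0 < b - a by lra.
have e0 : 0 < e.
  rewrite !lt_min invr_gt0 divr_gt0 ?mulr_gt0//= !subr_gt0 ax xb.
  by rewrite ltr0n.
have [m me] := ltr_add_invr e0; rewrite add0r in me.
set d : R := m.+1%:R^-1 in me.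
have d0 : 0 < d by rewrite invr_gt0.
have /andP[/andP[d1 d2] /andP[d3 d4]] :
    ((d < 2^-1) && (d < r / (2 * (b - a)))) && ((d < x - a) && (d < b - x)).
  by rewrite -!lt_min.
exists m; split; first by rewrite /= in_itv/= -/d; lra.
move=> y xy yb; rewrite -/d.
have [yr|yr] := leP y (x + r).
  by apply: le_trans (rP _ xy yr); apply: ler_wpM2l; lra.
have h1 := rP (x + r) ltac:(lra) (lexx _).
have h2 := F_nd (ltac:(lra) : a <= x + r) (ltW yr).
have h3 : (y - x) * d <= (b - a) * (r / (2 * (b - a))).
  by apply: ler_pM; lra.
have h4 : (b - a) * (r / (2 * (b - a))) = r / 2 by field; lra.
lra.
Qed.

(** By Lebesgue's density theorem almost every point of [B] lies in some
    [K m], so one of these compact sets has positive measure. It serves as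
    the part of the curve that is uniformly curved, seen from each of its
    points to the right. *)
Lemma density_compact : (0 < nu B)%E -> exists K eta,
  [/\ compact (K : set R), K `<=` `]a, b[, (0 < nu K)%E, 0 < eta &
    forall x y, K x -> x < y -> y < b -> eta * (y - x) <= fine (nu (B `&` `]x, y]))].
Proof.
move=> B0.
have [m Km] : exists m, (0 < nu (K m))%E.
  apply: contrapT => /forallNP H.
  have [N [mN N0 NP]] := lebesgue_density mB.
  have sub : B `<=` (\bigcup_m K m) `|` N.
    move=> x Bx; have [Nx|Nx] := pselect (N x); first by right.
    left; have [m Km] : exists m, K m x; last by exists m.
    apply: density_in_K => //; apply: contrapT => h; exact/Nx/NP.
  move: B0; apply/negP; rewrite -leNgt.
  have mU : measurable (\bigcup_m K m : set (measurableTypeR R)).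
    exact: bigcup_measurable.
  apply: le_trans (le_measure _ _ _ sub) _; rewrite ?inE//.
    exact: measurableU.
  apply: le_trans (measureU2 _ mU mN) _.
  rewrite [X in (_ + X)%E]N0 adde0.
  apply: le_trans (measure_sigma_subadditive _ _ mU (@subset_refl _ _)) _ => //.
  rewrite eseries0// => n _ _; apply/eqP; rewrite -measure_le0 leNgt.
  by apply/negP; exact: (H n).
have d0 : (0 : R) < m.+1%:R^-1 by rewrite invr_gt0.
exists (K m), m.+1%:R^-1; split => //.
- by move=> x [/= + _]; rewrite !in_itv/= => /andP[h1 h2];
    rewrite (lt_le_trans _ h1) ?ltrDl//= (le_lt_trans h2)// gtrBl.
- move=> x y [/= + KP] xy yb; rewrite in_itv/= => /andP[h1 _].
  have ax : a <= x by apply: le_trans h1; rewrite lerDl ltW.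
  by rewrite mulrC -FB//; [exact: KP|exact: ltW].
Qed.

End Density.

(** * Second differences and level strips *)

Section Bisection.
Variable R : realType.

(** Both halves of an interval contribute half of its error bound, so repeated
    bisection removes the error. It yields estimates that would otherwise come
    from integrating a derivative. *)
Lemma interval_additive_ge0 (D : R -> R -> R) (G : R -> R) (u v : R) :
  u <= v ->
  (forall x y z, u <= x -> x <= y -> y <= z -> z <= v -> D x z = D x y + D y z) ->
  (forall x y, u <= x -> x <= y -> y <= v -> - ((y - x) * (G y - G x)) <= D x y) ->
  0 <= D u v.
Proof.
move=> uv D_add D_ge.
have half n x y : u <= x -> x <= y -> y <= v ->
    - ((y - x) * (G y - G x)) / 2 ^+ n <= D x y.
  elim: n x y => [|n IH] x y ux xy yv; first by rewrite expr0 divr1 D_ge.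
  have h1 := IH x ((x + y) / 2) ux ltac:(lra) ltac:(lra).
  have h2 := IH ((x + y) / 2) y ltac:(lra) ltac:(lra) yv.
  rewrite (D_add x ((x + y) / 2) y)//; [|lra|lra].
  apply: le_trans (lerD h1 h2); rewrite le_eqVlt; apply/orP; left; apply/eqP.
  by rewrite exprS; field; rewrite expf_neq0.
set C := (v - u) * (G v - G u) in half.
have {}half n : - D u v * 2 ^+ n <= C.
  have := half n _ _ (lexx u) uv (lexx v); rewrite -/C ler_pdivrMr ?exprn_gt0//.
  by rewrite mulNr; lra.
rewrite leNgt; apply/negP => D0.
have D0' : 0 < - D u v by rewrite oppr_gt0.
have := half (Num.bound `|C / - D u v|).
rewrite mulrC -ler_pdivlMr// leNgt => /negP; apply.
apply: lt_le_trans (_ : (Num.bound `|C / - D u v|)%:R <= _).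
  by apply: le_lt_trans (ler_norm _) _; exact: (archi_boundP (normr_ge0 _)).
by rewrite -natrX ler_nat ltnW// ltn_expl.
Qed.

End Bisection.

Section SecondDifference.
Variables (R : realType) (a b eta : R) (gamma g : R -> R) (K : set R).
Hypothesis g_le : forall s t, a < s -> s < t -> t < b ->
  g s * (t - s) <= gamma t - gamma s.
Hypothesis g_ge : forall s t, a < s -> s < t -> t < b ->
  gamma t - gamma s <= g t * (t - s).
Hypothesis g_nd : forall s t, a < s -> s <= t -> t < b -> g s <= g t.
Hypothesis eta0 : 0 < eta.
Hypothesis compactK : compact K.
Hypothesis Kab : K `<=` `]a, b[.
Hypothesis K_growth : forall x y, K x -> x < y -> y < b ->
  eta * (y - x) <= g y - g x.

Local Notation nu := (@lebesgue_measure R).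

Let mK : measurable (K : set (measurableTypeR R)).
Proof. exact: compact_measurable. Qed.

Let mKI (i : interval R) : measurable (K `&` [set` i] : set (measurableTypeR R)).
Proof. by apply: measurableI => //; exact: measurable_itv. Qed.

Let nuKI x y : x <= y -> (nu (K `&` `]x, y]) <= (y - x)%:E)%E.
Proof.
rewrite le_eqVlt => /predU1P[->|xy].
  by rewrite set_itvoc0 setI0 measure0 subrr.
apply: (@le_trans _ _ (nu `]x, y]%classic)).
  by apply: le_measure; rewrite ?inE//; exact: measurable_itv.
by rewrite lebesgue_measure_itv/= lte_fin xy EFinB.
Qed.

Let fKI x y : x <= y -> nu (K `&` `]x, y]) \is a fin_num.
Proof. by move=> xy; rewrite ge0_fin_numE// (le_lt_trans (nuKI xy))// ltry. Qed.

(** The derivative of [gamma (t + h) - gamma t] is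
    [g (t + h) - g t], which is nonnegative everywhere and at least
    [eta * h] at points of [K]. *)
Lemma second_difference_ge h u v : 0 < h -> a < u -> u <= v -> v + h < b ->
  eta * h * fine (nu (K `&` `]u, v])) <=
  (gamma (v + h) - gamma v) - (gamma (u + h) - gamma u).
Proof.
move=> h0 au uv vhb.
pose phi t := gamma (t + h) - gamma t.
pose D x y := phi y - phi x - eta * h * fine (nu (K `&` `]x, y])).
rewrite -subr_ge0 -/(D u v).
apply: (@interval_additive_ge0 _ _ (fun t => g (t + h) + g t)) => //.
  move=> x y z ux xy yz zv; rewrite /D.
  have -> : K `&` `]x, z] = (K `&` `]x, y]) `|` (K `&` `]y, z]).
    rewrite -setIUr; congr (_ `&` _); apply/seteqP; split => t/=; rewrite !in_itv/=.
      move=> /andP[xt tz]; have [ty|yt] := leP t y; [left|right];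
        by rewrite ?xt ?ty ?yt ?tz.
    by move=> [/andP[xt ty]|/andP[yt tz]]; apply/andP; lra.
  rewrite measureU//; last first.
    apply/seteqP; split => // t [[_ /= h1] [_ /= h2]].
    by move: h1 h2; rewrite !in_itv/=; lra.
  rewrite fineD ?fKI//; lra.
move=> x y ux; rewrite le_eqVlt => /predU1P[->|xy] yv.
  by rewrite /D set_itvoc0 setI0 measure0/=; lra.
rewrite /D /phi.
have h1 : g (x + h) * (y - x) <= gamma (y + h) - gamma (x + h).
  have := @g_le (x + h) (y + h); rewrite (_ : y + h - (x + h) = y - x); last by ring.
  by apply; lra.
have h2 : gamma y - gamma x <= g y * (y - x) by apply: g_ge; lra.
(* The remaining estimate is trivial when the interval misses [K]; otherwise the
   growth of [g] from a point of [K] controls it. *)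
suff h3 : eta * h * fine (nu (K `&` `]x, y])) <= (g (y + h) - g x) * (y - x) by lra.
have [K0|/set0P[t [Kt /=]]] := eqVneq (K `&` `]x, y]%classic) set0.
  rewrite K0 measure0 mulr0 mulr_ge0//; last by lra.
  by rewrite subr_ge0 g_nd//; lra.
rewrite in_itv/= => /andP[xt ty].
apply: ler_pM.
- by rewrite mulr_ge0 ?ltW.
- exact: fine_ge0.
- have := @K_growth t (t + h) Kt; rewrite (_ : t + h - t = h); last by ring.
  have : g x <= g t by apply: g_nd; lra.
  have : g (t + h) <= g (y + h) by apply: g_nd; lra.
  by move=> i1 i2 /(_ ltac:(lra) ltac:(lra)); lra.
- by rewrite -lee_fin fineK ?fKI ?nuKI// ltW.
Qed.

Hypothesis gamma_cont : continuous gamma.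

(** The abscissae at which two translates of the part of the graph above [K],
    by vectors that differ by [h] horizontally and [v] vertically, are at
    vertical distance at most [r]. *)
Definition level_strip h v r : set R :=
  [set t | [/\ K t, K (t + h) & `|gamma (t + h) - gamma t - v| <= r]].

Lemma compact_level_strip h v r : compact (level_strip h v r).
Proof.
have -> : level_strip h v r = K `&` ((fun t => t + h) @^-1` K `&`
    (fun t => gamma (t + h) - gamma t - v) @^-1` `[- r, r]).
  apply/seteqP; split => t /=; rewrite in_itv/= -ler_norml.
    by move=> [].
  by move=> [? []].
have ch : continuous (fun t : R => t + h).
  by move=> t; apply: cvgD; [exact: cvg_id|exact: cvg_cst].
apply: compact_closedI => //; apply: closedI.
  by apply: (preimage_closed _ (compact_closed _ compactK)) => // t _; exact: ch.
apply: preimage_closed; last exact: itv_closed.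
move=> t _; apply: cvgB; last exact: cvg_cst.
apply: cvgB; last exact: gamma_cont.
by apply: (@continuous_comp _ _ _ (fun t => t + h) gamma); [exact: ch|exact: gamma_cont].
Qed.

(** Between the first and the last point of the strip, the increment of
    [gamma] over a step [h] varies by at most [2 * r] and by at least
    [eta * h] times the measure of the part of [K] in between. *)
Lemma measure_level_strip h v r : 0 < h -> 0 <= r ->
  (nu (level_strip h v r) <= (2 * r / (eta * h))%:E)%E.
Proof.
move=> h0 r0; set T := level_strip h v r.
have cT : compact T by exact: compact_level_strip.
have mT : measurable (T : set (measurableTypeR R)) by exact: compact_measurable.
have eh : 0 < eta * h by rewrite mulr_gt0.
have [T0|/set0P Tn0] := eqVneq T set0.
  by rewrite T0 measure0 lee_fin divr_ge0 ?mulr_ge0// ltW.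
have cid : {within T, continuous (id : R -> R)}.
  by apply: continuous_subspaceT => t; exact: cvg_id.
have [t0 /set_mem Tt0 t0min] := compact_EVT_min Tn0 cT cid.
have [t1 /set_mem Tt1 t1max] := compact_EVT_max Tn0 cT cid.
have {}t0min t : T t -> t0 <= t by move=> /mem_set/t0min.
have {}t1max t : T t -> t <= t1 by move=> /mem_set/t1max.
have t01 := t0min _ Tt1.
have [Kt0 _ v0] := Tt0.
have [_ Kt1 v1] := Tt1.
have /= := Kab Kt0; rewrite in_itv/= => /andP[at0 _].
have /= := Kab Kt1; rewrite in_itv/= => /andP[_ t1b].
have := second_difference_ge h0 at0 t01 t1b.
rewrite -ler_pdivlMl// => le1.
have sub : T `<=` [set t0] `|` (K `&` `]t0, t1]).
  move=> t Tt; have := t0min _ Tt; rewrite le_eqVlt => /predU1P[->|tt].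
    by left.
  by right; split; [case: Tt|rewrite /= in_itv/= tt t1max].
have m1 : measurable ([set t0] : set (measurableTypeR R)) by exact: measurable_set1.
apply: (@le_trans _ _ (nu [set t0] + nu (K `&` `]t0, t1]))%E).
  apply: (@le_trans _ _ (nu ([set t0] `|` (K `&` `]t0, t1])))).
    by apply: le_measure => //; rewrite inE//; exact: measurableU.
  exact: (measureU2 _ m1 (mKI _)).
rewrite [X in (X + _)%E]lebesgue_measure_set1.
rewrite add0e -(fineK (fKI t01)) lee_fin (le_trans le1)//.
rewrite mulrC; apply: ler_wpM2r; first by rewrite invr_ge0 ltW.
by move: v0 v1; rewrite !ler_norml; lra.
Qed.

End SecondDifference.

(** * Hausdorff content and Frostman weights *)

Section Greedy.
Variables (R : realType) (I : finType) (T : eqType) (n : nat).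
Variable cell : nat -> I -> T.
Variable cap : nat -> R.
Hypothesis cap_ge0 : forall j, 0 <= cap j.

Let load (w : I -> R) j t := \sum_(q | cell j q == t) w q.

(** Treat the points one after the other and give each the largest weight that
    all its cells can still take: one of its cells becomes full, and it stays
    full because weights never decrease. *)
Lemma greedy_weights : exists w : I -> R,
  [/\ forall p, 0 <= w p,
      forall j t, (j <= n)%N -> load w j t <= cap j &
      forall p, exists2 j, (j <= n)%N & load w j (cell j p) = cap j].
Proof.
suff [w [w0 wc ws]] : exists w : I -> R,
  [/\ forall p, 0 <= w p,
      forall j t, (j <= n)%N -> load w j t <= cap j &
      forall p, p \in enum I ->
        exists2 j, (j <= n)%N & load w j (cell j p) = cap j].
  by exists w; split => // p; apply: ws; rewrite mem_enum.
elim: (enum I) => [|p s [w [w0 wc ws]]].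
  exists (fun=> 0); split => // j t _.
  by rewrite /load big1.
(* The room left in the cell of level [j] that contains [p]. *)
pose slack j := cap j - load w j (cell j p).
pose j0 := [arg min_(j < ord0 : 'I_n.+1) slack j]%O.
have [j0n j0min] : (j0 <= n)%N /\ forall j, (j <= n)%N -> slack j0 <= slack j.
  rewrite /j0; case: arg_minP => // i _ imin; split; first by rewrite -ltnS.
  by move=> j; rewrite -ltnS => jn; exact: (imin (Ordinal jn)).
have sl0 : 0 <= slack j0 by rewrite subr_ge0 wc.
pose w' q := w q + (if q == p then slack j0 else 0).
have loadE j t : load w' j t =
    load w j t + (if cell j p == t then slack j0 else 0).
  rewrite /load big_split/=; congr (_ + _).
  rewrite -big_mkcondr/=; case: ifPn => [/eqP <-|e].
    rewrite (big_pred1 p)// => q /=.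
    by case: (eqVneq q p) => [->|]; rewrite ?eqxx ?andbF.
  rewrite big_pred0// => q.
  by case: (eqVneq q p) => [->|]; rewrite ?(negbTE e) ?andbF.
have w'c j t : (j <= n)%N -> load w' j t <= cap j.
  move=> jn; rewrite loadE; case: ifPn => [/eqP <-|_]; last by rewrite addr0 wc.
  by have := j0min _ jn; rewrite /slack; lra.
exists w'; split => //.
  by move=> q; rewrite addr_ge0//; case: ifP.
move=> q; rewrite inE => /predU1P[->|qs].
  by exists j0 => //; rewrite loadE eqxx /slack; lra.
have [j jn jE] := ws _ qs; exists j => //.
apply/eqP; rewrite eq_le w'c//= -jE loadE lerDl.
by case: ifP.
Qed.

Hypothesis nested : forall i j p q, (i <= j)%N ->
  cell j p = cell j q -> cell i p = cell i q.

(** The coarsest full cells around the points are either equal or disjoint,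
    since cells are nested. They therefore form a partition, along which the
    total weight is a sum of capacities; this is what will be compared with
    the cost of a cover. *)
Lemma saturated_cover : exists w : I -> R,
  [/\ forall p, 0 <= w p,
      forall j t, (j <= n)%N -> load w j t <= cap j &
      exists lev : I -> nat,
        [/\ forall p, (lev p <= n)%N,
            forall p q, cell (lev p) q = cell (lev p) p -> lev q = lev p &
            \sum_p w p = \sum_(v <- undup [seq (lev p, cell (lev p) p) | p <- enum I]) cap v.1]].
Proof.
have [w [w0 wc ws]] := greedy_weights.
exists w; split => //.
have ex p : exists j, (j <= n)%N && (load w j (cell j p) == cap j).
  by have [j jn jE] := ws p; exists j; rewrite jn jE/=.
pose lev p := ex_minn (ex p).
have levP p : [/\ (lev p <= n)%N, load w (lev p) (cell (lev p) p) = cap (lev p)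
    & forall j, (j <= n)%N -> load w j (cell j p) = cap j -> (lev p <= j)%N].
  rewrite /lev; case: ex_minnP => m /andP[mn /eqP mE] min; split => // j jn jE.
  by apply: min; rewrite jn jE/=.
have levle p q : cell (lev p) q = cell (lev p) p -> (lev q <= lev p)%N.
  move=> e; have [pn pE _] := levP p; have [_ _ qmin] := levP q.
  by apply: qmin => //; rewrite e.
have leveq p q : cell (lev p) q = cell (lev p) p -> lev q = lev p.
  move=> e; apply/eqP; rewrite eqn_leq levle//= levle//.
  exact: (nested (levle _ _ e)).
exists lev; split => //; first by move=> p; have [] := levP p.
pose f p := (lev p, cell (lev p) p).
have fU p : f p \in undup [seq f p | p <- enum I].
  by rewrite mem_undup map_f// mem_enum.
(* Double counting of the pairs of a point and its coarsest full cell. *)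
transitivity (\sum_p \sum_(v <- undup [seq f p | p <- enum I] | f p == v) w p).
  apply: eq_bigr => p _; rewrite big_mkcond/=.
  rewrite (bigD1_seq (f p))//= ?undup_uniq// eqxx big1 ?addr0// => v.
  by rewrite eq_sym => /negbTE ->.
rewrite (exchange_big_dep xpredT)//= big_seq [RHS]big_seq.
apply: eq_bigr => v; rewrite mem_undup => /mapP[p _ ->].
have [_ <- _] := levP p; apply: eq_bigl => q /=.
apply/eqP/eqP => [[-> //]|e].
by rewrite /f (leveq _ _ e) e.
Qed.

End Greedy.

Section Content.
Variable R : realType.
Implicit Types (E : set (R * R)) (s r : R).

Lemma diam_pow_ge0 s (A : set (R * R)) : (0 <= diam_pow s A)%E.
Proof. by rewrite /diam_pow; case: ifP => // _; exact: poweR_ge0. Qed.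

Lemma le_diam (A : set (R * R)) (d : R) :
  (forall p q, A p -> A q -> plane_dist p q <= d) -> (diam A <= d%:E)%E.
Proof.
move=> Ad; apply: ge_ereal_sup => _ [p Ap [q Aq <-]].
by rewrite lee_fin Ad.
Qed.

Lemma diam_ge (A : set (R * R)) p q : A p -> A q ->
  ((plane_dist p q)%:E <= diam A)%E.
Proof. by move=> Ap Aq; apply: ereal_sup_ubound; exists p => //; exists q. Qed.

Lemma plane_dist_ge0 (p q : R * R) : 0 <= plane_dist p q.
Proof. exact: sqrtr_ge0. Qed.

Lemma diam_ge0 (A : set (R * R)) : A !=set0 -> (0 <= diam A)%E.
Proof.
move=> [p Ap]; apply: le_trans (diam_ge Ap Ap).
by rewrite lee_fin plane_dist_ge0.
Qed.

Lemma le_diam_pow s (A : set (R * R)) (d : R) : 0 <= s -> 0 <= d ->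
  (diam A <= d%:E)%E -> (diam_pow s A <= (d `^ s)%:E)%E.
Proof.
move=> s0 d0 Ad; rewrite /diam_pow; case: ifPn => [_|/set0P A0].
  by rewrite lee_fin powR_ge0.
rewrite -poweR_EFin; apply: gt0_ler_poweR => //.
  by rewrite in_itv/= leey andbT diam_ge0.
by rewrite in_itv/= leey andbT lee_fin.
Qed.

Lemma hausdorff_premeasure_ge0 s d E : (0 <= hausdorff_premeasure s d E)%E.
Proof.
apply: le_ereal_inf_tmp => _ [U _ <-].
by apply: nneseries_ge0 => i _ _; exact: diam_pow_ge0.
Qed.

Lemma hausdorff_measure_neq0 s E : hausdorff_measure s E != 0%E ->
  exists2 d, 0 < d & (0 < hausdorff_premeasure s d E)%E.
Proof.
apply: contra_neqP => H; apply/eqP; rewrite eq_le; apply/andP; split.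
  apply: ge_ereal_sup => _ [d d0 <-]; rewrite leNgt; apply/negP => ?.
  by apply: H; exists d.
apply: le_trans (hausdorff_premeasure_ge0 s 1 E) _.
by apply: ereal_sup_ubound; exists 1 => //=.
Qed.

(** Positive Hausdorff measure forbids cheap covers by sets of any size: the
    sets of a cheap cover are automatically small. The covers below may
    therefore mix squares of all sizes. *)
Lemma hausdorff_content_gt0 s E : 0 < s -> hausdorff_measure s E != 0%E ->
  exists2 c : R, 0 < c & forall U : nat -> set (R * R),
    E `<=` \bigcup_i U i -> (c%:E <= \sum_(0 <= i <oo) diam_pow s (U i))%E.
Proof.
move=> s0 /hausdorff_measure_neq0[d d0 h0].
set h := hausdorff_premeasure s d E in h0 *.
(* Below the cost [d `^ s], every set of a cover has diameter less than [d]. *)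
have [c [c0 cd ch]] : exists c : R, [/\ 0 < c, c <= d `^ s & (c%:E <= h)%E].
  have dp : 0 < d `^ s by rewrite powR_gt0.
  move: h0; case: h => [r| |]//.
  - rewrite lte_fin => r0; exists (Num.min r (d `^ s)).
    by rewrite lt_min r0 dp ge_min lexx orbT lee_fin ge_min lexx.
  - by exists (d `^ s); rewrite leey.
exists c => // U EU; rewrite leNgt; apply/negP => Uc.
have : (h <= \sum_(0 <= i <oo) diam_pow s (U i))%E.
  apply: ereal_inf_lbound; exists U => //; split => // i.
  have Ui : (diam_pow s (U i) < (d `^ s)%:E)%E.
    apply: (le_lt_trans _ (lt_le_trans Uc _)); last by rewrite lee_fin.
    rewrite (@nneseriesD1 _ _ i xpredT)//; last by move=> *; exact: diam_pow_ge0.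
    by rewrite leeDl// nneseries_ge0// => *; exact: diam_pow_ge0.
  move: Ui; rewrite /diam_pow; case: ifPn => [/eqP -> _|/set0P U0].
    by apply: le_diam.
  move=> Ud; rewrite leNgt; apply/negP => dU; move: Ud; apply/negP.
  rewrite -leNgt -poweR_EFin; apply: gt0_ler_poweR; last exact: ltW.
  - exact: ltW.
  - by rewrite in_itv/= leey andbT lee_fin ltW.
  - by rewrite in_itv/= leey andbT diam_ge0.
by move=> hU; have := lt_le_trans Uc (le_trans ch hU); rewrite ltxx.
Qed.

Lemma hausdorff_dim_gt r E : 0 <= r -> (r%:E < hausdorff_dim E)%E ->
  exists2 s : R, r < s & hausdorff_measure s E != 0%E.
Proof.
move=> r0 rE.
have [s rs sE] : exists2 s : R, r < s & (s%:E < hausdorff_dim E)%E.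
  move: rE; case: hausdorff_dim => [x| |]//.
    by rewrite lte_fin => rx; exists ((r + x) / 2); rewrite ?lte_fin; lra.
  by exists (r + 1); rewrite ?ltry//; lra.
exists s => //; apply/eqP => sE0; move: sE; apply/negP; rewrite -leNgt.
by apply: ereal_inf_lbound; exists s => //; split => //; lra.
Qed.

End Content.

Section Cells.
Variable R : realType.
Implicit Types (E : set (R * R)) (p q : R * R).

(** Squares are represented by the integer coordinates of their corners. They
    are half-open, so that each level partitions the plane and refines the
    levels below it. *)
Definition dyadic_cell (j : nat) p : int * int :=
  (Num.floor (2 ^+ j * p.1), Num.floor (2 ^+ j * p.2)).

Lemma floor_half (x y : R) : Num.floor (2 * x) = Num.floor (2 * y) ->
  Num.floor x = Num.floor y.
Proof.
wlog : x y / x <= y => [hw|xy e].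
  by have [/hw//|/ltW /hw h e] := leP x y; apply/esym/h.
apply/eqP; rewrite eq_le le_floor//= floor_ge_int.
have h : (Num.floor y)%:~R <= y by exact: floor_le.
have : 2 * Num.floor y <= Num.floor (2 * y).
  by rewrite floor_ge_int intrM; rewrite ler_pM2l.
by rewrite -e floor_ge_int; rewrite intrM; rewrite ler_pM2l.
Qed.

Lemma dyadic_cell_nested i j p q : (i <= j)%N ->
  dyadic_cell j p = dyadic_cell j q -> dyadic_cell i p = dyadic_cell i q.
Proof.
elim: j => [|j IH]; first by rewrite leqn0 => /eqP ->.
rewrite leq_eqVlt => /predU1P[-> //|/IH{}IH [e1 e2]]; apply: IH.
by rewrite /dyadic_cell; congr (_, _); apply: floor_half; rewrite !mulrA -!exprS.
Qed.

Lemma floor_eq_dist (x y : R) : Num.floor x = Num.floor y -> `|x - y| <= 1.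
Proof.
move=> e; have := floor_itv x; have := floor_itv y.
by rewrite e intrD ler_norml; lra.
Qed.

Lemma dyadic_cell_dist j p q : dyadic_cell j p = dyadic_cell j q ->
  plane_dist p q <= 2 * 2 ^- j.
Proof.
have j0 : (0 : R) < 2 ^+ j by rewrite exprn_gt0.
have coord (x y : R) : Num.floor (2 ^+ j * x) = Num.floor (2 ^+ j * y) ->
    (x - y) ^+ 2 <= (2 ^- j) ^+ 2.
  move=> /floor_eq_dist; rewrite -mulrBr normrM gtr0_norm// mulrC -ler_pdivlMr//.
  rewrite mul1r => h; rewrite -(real_normK (num_real _)).
  by rewrite ler_pXn2r// nnegrE ?invr_ge0 ?ltW.
move=> [/coord h1 /coord h2]; rewrite /plane_dist.
have k0 : (0 : R) <= 2 * 2 ^- j by rewrite mulr_ge0// invr_ge0 ltW.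
rewrite -(ger0_norm k0) -sqrtr_sqr ler_sqrt ?sqr_ge0//.
by rewrite exprMn; have := sqr_ge0 (2 ^- j : R); lra.
Qed.

Lemma dyadic_cell_finite E j : compact E -> finite_set (dyadic_cell j @` E).
Proof.
move=> /compact_bounded/ex_strict_bound_gt0[M M0 EM].
pose N := `|Num.ceil (2 ^+ j * M)|%N.
have j0 : (0 : R) < 2 ^+ j by rewrite exprn_gt0.
pose f (k : nat * nat) : int * int := (k.1%:Z - N%:Z, k.2%:Z - N%:Z).
apply: (@sub_finite_set _ _ (f @` (`I_(N.*2.+1) `*` `I_(N.*2.+1)))).
  have coord (x : R) : `|x| < M ->
      exists2 k, (k < N.*2.+1)%N & k%:Z - N%:Z = Num.floor (2 ^+ j * x).
    rewrite ltr_norml => /andP[h1 h2].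
    have NM : 2 ^+ j * M <= N%:R.
      apply: le_trans (ceil_ge _) _.
      by rewrite [leRHS]pmulrn ler_int lez_abs.
    have l1 : - N%:Z <= Num.floor (2 ^+ j * x).
      by rewrite floor_ge_int rmorphN/=; nra.
    have l2 : Num.floor (2 ^+ j * x) <= N%:Z.
      rewrite -ltzD1 floor_lt_int rmorphD/=; nra.
    exists (absz (Num.floor (2 ^+ j * x) + N%:Z)); last by rewrite gez0_abs; lia.
    by lia.
  move=> _ [p Ep <-]; have /= := EM _ Ep; rewrite prod_normE/= gt_max.
  move=> /andP[/coord[k1 k1N e1] /coord[k2 k2N e2]].
  by exists (k1, k2) => //; rewrite /f/= e1 e2.
by apply: finite_image; apply: finite_setX; exact: finite_II.
Qed.

End Cells.

Section Frostman.
Variable R : realType.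

Lemma powR_exprn (x s : R) (m : nat) : 0 <= x -> (x ^+ m) `^ s = (x `^ s) ^+ m.
Proof.
move=> x0; elim: m => [|m IH]; first by rewrite !expr0 powR1.
by rewrite !exprS powRM ?exprn_ge0// IH.
Qed.

(** Identifies the capacity [beta ^+ j] with the [s]-th power of a side
    length. *)
Lemma powR_dyadic (s : R) (j : nat) : (2 `^ (- s)) ^+ j = (2 ^- j) `^ s.
Proof.
by rewrite -exprVn powR_exprn ?invr_ge0// -powR_inv1// -powRrM mulN1r.
Qed.

Lemma powR_half_lt (s : R) : 1 < s -> 2^-1 `^ s < (2^-1 : R).
Proof.
move=> s1; rewrite -[s](subrKC 1) powRD; last by rewrite invr_eq0 pnatr_eq0 implybT.
rewrite powRr1 ?invr_ge0// gtr_pMr ?invr_gt0//.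
rewrite [ltRHS](_ : _ = 1 `^ (s - 1)); last by rewrite powR1.
apply: gt0_ltr_powR; rewrite ?nnegrE//; first by rewrite subr_gt0.
by rewrite invf_lt1// ltr1n.
Qed.

(** Frostman's lemma down to the scale [2 ^- n], with a total mass bounded
    below independently of [n]. One point of the set is chosen in each dyadic
    square of side [2 ^- n] that it meets; the coarsest full squares of the
    greedy weights cover the set, so their total capacity is at least the
    content. *)
Lemma discrete_frostman (E : set (R * R)) (s : R) :
  compact E -> 0 < s -> hausdorff_measure s E != 0%E ->
  exists2 c : R, 0 < c & forall n : nat,
    exists (I : finType) (pt : I -> R * R) (w : I -> R),
    [/\ forall i, E (pt i), forall i, 0 <= w i,
        forall j t, (j <= n)%N ->
          \sum_(q | dyadic_cell j (pt q) == t) w q <= (2 `^ (- s)) ^+ j &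
        c <= \sum_i w i].
Proof.
move=> cE s0 /(hausdorff_content_gt0 s0)[c c0 cP].
have t0 : (0 : R) < 2 `^ s by rewrite powR_gt0.
exists (c / 2 `^ s); first by rewrite divr_gt0.
move=> n.
have /finite_seqP[l lE] := dyadic_cell_finite n cE.
have pick_ex (v : int * int) : exists p, v \in l -> E p /\ dyadic_cell n p = v.
  have [vl|vl] := boolP (v \in l); last by exists 0.
  have : [set` l] v by [].
  by rewrite -lE => -[p Ep pv]; exists p.
(* Indices outside the list never occur; [0] only makes [pick] total. *)
have [pick pickP] := choice pick_ex.
pose pt (i : 'I_(size l)) := pick (nth 0 l i).
have ptP i : E (pt i) by apply: (pickP _ _).1; rewrite mem_nth.
pose cell j (i : 'I_(size l)) := dyadic_cell j (pt i).
have cap0 j : 0 <= (2 `^ (- s) : R) ^+ j by rewrite exprn_ge0 ?powR_ge0.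
have nested i j p q : (i <= j)%N -> cell j p = cell j q -> cell i p = cell i q.
  by move=> ij; exact: dyadic_cell_nested.
have [w [w0 wc [lev [levn _ wE]]]] := @saturated_cover R _ _ n cell _ cap0 nested.
exists 'I_(size l), pt, w; split => //.
set L := undup _ in wE; rewrite wE ler_pdivrMr// mulrC.
(* The finite family of full cells, completed by empty sets to a sequence. *)
pose U i : set (R * R) := if (i < size L)%N then
  [set p | dyadic_cell (nth (0%N, (0, 0)) L i).1 p = (nth (0%N, (0, 0)) L i).2]
  else set0.
have EU : E `<=` \bigcup_i U i.
  move=> x Ex.
  have xl : dyadic_cell n x \in l.
    by have : [set` l] (dyadic_cell n x) by rewrite -lE; exists x.
  have il : (index (dyadic_cell n x) l < size l)%N by rewrite index_mem.
  pose i := Ordinal il.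
  have ix : cell n i = dyadic_cell n x.
    by rewrite /cell /pt/= nth_index// (pickP _ xl).2.
  have vL : (lev i, cell (lev i) i) \in L.
    by rewrite mem_undup; apply: map_f; rewrite mem_enum.
  exists (index (lev i, cell (lev i) i) L) => //.
  rewrite /U index_mem vL nth_index//=.
  by apply/esym; apply: (dyadic_cell_nested (levn i)).
have := cP _ EU.
rewrite (nneseries_split 0 (size L)); last by move=> *; exact: diam_pow_ge0.
rewrite add0n [X in (_ + X)%E]eseries0 ?adde0; last first.
  by move=> i iL _; rewrite /U ltnNge iL/= /diam_pow eqxx.
move=> h; rewrite -lee_fin; apply: le_trans h _.
rewrite (big_nth (0%N, (0, 0))) mulr_sumr -sumEFin.
rewrite big_nat_cond [leRHS]big_nat_cond.
apply: lee_sum => i /andP[/andP[_ iL] _].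
have h2 (j : nat) : (0 : R) <= 2 ^- j by rewrite invr_ge0 exprn_ge0.
have -> : 2 `^ s * (2 `^ (- s)) ^+ (nth (0%N, (0, 0)) L i).1 =
    (2 * 2 ^- (nth (0%N, (0, 0)) L i).1) `^ s.
  by rewrite powRM// powR_dyadic.
apply: le_diam_pow; [exact: ltW|by rewrite mulr_ge0|].
apply: le_diam => p q; rewrite /U iL/= => pE qE.
by apply: dyadic_cell_dist; rewrite pE qE.
Qed.

End Frostman.

(** * Second moment bound for unions *)

Section Gram.
Context d (T : measurableType d) (R : realType) (m : {measure set T -> \bar R}).

(** The double sum is the integral of the square of a combination of indicator
    functions. *)
Lemma gram_ge0 (I : finType) (A : I -> set T) (c : I -> R) :
  (forall i, measurable (A i)) -> (forall i, (m (A i) < +oo)%E) ->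
  0 <= \sum_i \sum_j c i * c j * fine (m (A i `&` A j)).
Proof.
move=> mA fA.
have mAA i j : measurable (A i `&` A j) by exact: measurableI.
have fAA i j : (m (A i `&` A j) < +oo)%E.
  by apply: le_lt_trans (fA i); apply: le_measure; rewrite ?inE//; exact: subIsetl.
have iind B : measurable B -> (m B < +oo)%E ->
    m.-integrable setT (fun x => (\1_B x : R)%:E).
  move=> mB fB; apply/integrableP; split.
    by apply/measurable_EFinP; exact: measurable_indic.
  under eq_integral do rewrite gee0_abs ?lee_fin//.
  by rewrite integral_indic// setIT.
have iAA i j : m.-integrable setT (fun x => (c i * c j)%:E * (\1_(A i `&` A j) x)%:E)%E.
  by apply: integrableZl => //; exact: iind.
pose f x := (\sum_i \sum_j (c i * c j)%:E * (\1_(A i `&` A j) x)%:E)%E.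
have f0 x : (0 <= f x)%E.
  have -> : f x = ((\sum_i c i * \1_(A i) x) ^+ 2)%:E.
    rewrite expr2 big_distrlr/= -sumEFin; apply: eq_bigr => i _.
    rewrite -sumEFin; apply: eq_bigr => j _.
    by rewrite -EFinM indicI/= mulrACA.
  by rewrite lee_fin sqr_ge0.
have : (0 <= \int[m]_x f x)%E by apply: integral_ge0 => x _; exact: f0.
rewrite /f integral_sum//; last first.
  by move=> i; apply: integrable_sum.
under eq_bigr do rewrite integral_sum//.
rewrite -lee_fin -sumEFin; congr (_ <= _)%E; apply: eq_bigr => i _.
rewrite -sumEFin; apply: eq_bigr => j _.
rewrite integralZl//; last exact: iind.
by rewrite integral_indic// setIT [RHS]EFinM fineK// ge0_fin_numE.
Qed.

(** Cauchy-Schwarz in the form of a second moment bound: sets that overlap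
    little on average cover a large set. *)
Lemma measure_cover_ge (I : finType) (A : I -> set T) (w : I -> R) (N : set T)
    (M S : R) :
  (forall i, measurable (A i)) -> measurable N -> (forall i, A i `<=` N) ->
  (m N < +oo)%E -> 0 < M -> 0 < S ->
  M <= \sum_i w i * fine (m (A i)) ->
  \sum_i \sum_j w i * w j * fine (m (A i `&` A j)) <= S ->
  ((M ^+ 2 / S)%:E <= m N)%E.
Proof.
move=> mA mN AN fN M0 S0 hM hS.
have fA i : (m (A i) < +oo)%E.
  by apply: le_lt_trans fN; apply: le_measure; rewrite ?inE//; exact: AN.
pose A' (o : unit + I) := if o is inr i then A i else N.
(* The optimal multiple of the indicator of [N] to subtract. *)
pose lam := S / M.
have lam0 : 0 < lam by rewrite divr_gt0.
pose w' (o : unit + I) := if o is inr i then w i else - lam.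
have mA' o : measurable (A' o) by case: o => /=.
have fA' o : (m (A' o) < +oo)%E by case: o => /=.
have := gram_ge0 w' mA' fA'.
have sumo (F : unit + I -> R) : \sum_o F o = F (inl tt) + \sum_i F (inr i).
  by rewrite big_sumType/= (big_pred1 tt)// => -[].
have sumo2 (F : unit + I -> unit + I -> R) : \sum_o \sum_o' F o o' =
    F (inl tt) (inl tt) + \sum_i F (inl tt) (inr i) +
    \sum_i (F (inr i) (inl tt) + \sum_j F (inr i) (inr j)).
  by rewrite sumo sumo; congr (_ + _); apply: eq_bigr => i _; rewrite sumo.
rewrite sumo2 /=.
rewrite big_split/= setIid.
have -> : \sum_i - lam * w i * fine (m (N `&` A i)) =
    - lam * \sum_i w i * fine (m (A i)).
  by rewrite mulr_sumr; apply: eq_bigr => i _; rewrite setIidr// mulrA.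
have -> : \sum_i w i * - lam * fine (m (A i `&` N)) =
    - lam * \sum_i w i * fine (m (A i)).
  rewrite mulr_sumr; apply: eq_bigr => i _; rewrite setIidl//.
  by rewrite mulrCA mulrA.
move=> h; rewrite -(fineK (_ : m N \is a fin_num)) ?ge0_fin_numE// lee_fin.
rewrite ler_pdivrMr//.
have lM : lam * M = S by rewrite /lam divfK// gt_eqF.
have : lam * M <= lam * \sum_i w i * fine (m (A i)) by rewrite ler_wpM2l ?(ltW lam0).
rewrite lM => h2.
have h3 : S <= lam ^+ 2 * fine (m N) by lra.
rewrite -(ler_pM2l S0) -lM.
have := ler_wpM2l (sqr_ge0 M) h3; rewrite -!lM; lra.
Qed.

End Gram.

(** * Thickened translates of a graph *)

Section Translation.
Variable R : realType.
Local Notation nu := (@lebesgue_measure R).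

Lemma measurable_shift (t : R) :
  measurable_fun setT (fun x : measurableTypeR R => (x - t : measurableTypeR R)).
Proof. by apply: measurable_funB => //; exact: measurable_cst. Qed.

(** The image measure of a translation agrees with Lebesgue measure on
    half-open intervals. *)
Lemma lebesgue_measure_shift (t : R) (A : set (measurableTypeR R)) :
  measurable A -> nu [set x | A (x - t)] = nu A.
Proof.
move=> mA; pose f (x : measurableTypeR R) : measurableTypeR R := x - t.
have mf : measurable_fun setT f := measurable_shift t.
pose mu : {measure set (measurableTypeR R) -> \bar R} := pushforward nu f.
have /(_ _ A mA) -> // := @lebesgue_measure_unique R (mu mf).
move=> _ [[x y] /= xy <-]; rewrite /mu/= /pushforward.
have -> : f @^-1` `]x, y] = `](x + t), (y + t)]%classic.
  by apply/seteqP; split => z /=; rewrite /f !in_itv/= ltrBrDr lerBlDr.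
rewrite !lebesgue_measure_itv/= !lte_fin ltrD2r.
by case: ifP => // _; rewrite -!EFinB; congr EFin; ring.
Qed.

End Translation.

Section ThickGraphs.
Variables (R : realType) (gamma : R -> R) (K : set R).
Hypothesis gamma_cont : continuous gamma.
Hypothesis compactK : compact K.
Local Notation nu := (@lebesgue_measure R).
Local Notation mR := (measurableTypeR R).

(** The translate by [p] of the vertical [r]-neighbourhood of the part of the
    graph of [gamma] that lies above [K]. *)
Definition thick_graph (r : R) (p : R * R) : set (mR * mR) :=
  [set z | K (z.1 - p.1) /\ `|z.2 - p.2 - gamma (z.1 - p.1)| <= r].

Let mK : measurable (K : set mR).
Proof. exact: compact_measurable. Qed.

Let mKs t : measurable ([set x | K (x - t)] : set mR).
Proof.
rewrite -[X in measurable X]setTI; exact: (measurable_shift t measurableT mK).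
Qed.

Lemma measurable_thick_graph r p : measurable (thick_graph r p).
Proof.
have -> : thick_graph r p = (fst @^-1` [set x | K (x - p.1)]) `&`
    ((fun z : mR * mR => z.2 - p.2 - gamma (z.1 - p.1)) @^-1` `[- r, r]).
  by apply/seteqP; split => z /=; rewrite in_itv/= -ler_norml.
apply: measurableI.
  by rewrite -[X in measurable X]setTI; apply: (measurable_fst measurableT); exact: mKs.
rewrite -[X in measurable X]setTI.
have mf : measurable_fun setT (fun z : mR * mR => z.2 - p.2 - gamma (z.1 - p.1)).
  apply: measurable_funB.
    apply: measurable_funB; [exact: measurable_snd|exact: measurable_cst].
  apply: (measurableT_comp (f := gamma)); first exact: continuous_measurable_fun.
  apply: measurable_funB; [exact: measurable_fst|exact: measurable_cst].
exact: (mf measurableT _ (measurable_itv _)).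
Qed.

Lemma nu_centered (c r : R) : 0 <= r ->
  nu [set y | `|y - c| <= r] = (2 * r)%:E.
Proof.
move=> r0; rewrite (_ : [set y | _] = `[c - r, c + r]%classic).
  rewrite lebesgue_measure_itv/= lte_fin; case: ifPn => h.
    by rewrite -EFinB; congr EFin; ring.
  by congr EFin; rewrite -leNgt in h; lra.
by apply/seteqP; split => y /=; rewrite in_itv/= ler_distl.
Qed.

Lemma measure_thick_graph r p : 0 <= r ->
  (nu \x nu)%E (thick_graph r p) = ((2 * r)%:E * nu K)%E.
Proof.
move=> r0; rewrite /product_measure1/=.
rewrite -(lebesgue_measure_shift p.1 mK).
under eq_integral => x _.
  rewrite (_ : nu (xsection _ _) = (2 * r)%:E * (\1_[set x | K (x - p.1)] x)%:E)%E.
    over.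
  rewrite indicE; have [Kx|Kx] := pselect (K (x - p.1)).
    rewrite mem_set// mule1 -(nu_centered (p.2 + gamma (x - p.1)) r0); congr (nu _).
    apply/seteqP; split => y /=; rewrite xsectionE /thick_graph/=.
      by move=> [_]; rewrite opprD addrA.
    by rewrite opprD addrA.
  rewrite memNset//= mule0 [X in nu X](_ : _ = set0) ?measure0//.
  by apply/seteqP; split => // y; rewrite xsectionE /thick_graph/= => -[].
rewrite ge0_integralZl//; last 2 first.
  by apply/measurable_EFinP; exact: measurable_indic.
  by rewrite lee_fin mulr_ge0.
by rewrite integral_indic// setIT.
Qed.

(** Above the same abscissa, translates of a Lipschitz graph are close only
    when the translation vectors differ mostly horizontally. *)
Lemma thick_graph_disjoint L r p q : 0 <= L ->
  (forall s t, `|gamma s - gamma t| <= L * `|s - t|) ->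
  thick_graph r p `&` thick_graph r q !=set0 ->
  `|p.2 - q.2| <= L * `|p.1 - q.1| + 2 * r.
Proof.
move=> L0 lip [z [[_ h1] [_ h2]]].
have := lip (z.1 - p.1) (z.1 - q.1).
rewrite (_ : z.1 - p.1 - (z.1 - q.1) = - (p.1 - q.1)); last by ring.
rewrite normrN; move: h1 h2; rewrite !ler_norml => /andP[a1 a2] /andP[b1 b2].
by move=> /andP[c1 c2]; apply/andP; split; lra.
Qed.

Variable eta : R.
Hypothesis strip : forall h v r, 0 < h -> 0 <= r ->
  (nu (level_strip gamma K h v r) <= (2 * r / (eta * h))%:E)%E.

(** The vertical sections of the overlap have length at most [2 * r], and
    are empty away from a translate of a level strip of height [2 * r]. *)
Let strip_overlap r p q : 0 <= r -> q.1 < p.1 ->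
  ((nu \x nu)%E (thick_graph r p `&` thick_graph r q)
    <= (8 * r ^+ 2 / (eta * (p.1 - q.1)))%:E)%E.
Proof.
move=> r0 qp; have h0 : 0 < p.1 - q.1 by rewrite subr_gt0.
set T := level_strip gamma K (p.1 - q.1) (p.2 - q.2) (2 * r).
have mT : measurable (T : set mR).
  by apply: compact_measurable; exact: compact_level_strip.
have mTs : measurable ([set x | T (x - p.1)] : set mR).
  by rewrite -[X in measurable X]setTI; exact: (measurable_shift p.1 measurableT mT).
rewrite /product_measure1/=.
apply: (@le_trans _ _ (\int[nu]_x ((2 * r)%:E * (\1_[set x | T (x - p.1)] x)%:E))%E).
  apply: ge0_le_integral => //.
  - apply: lebesgue_integral_fubini.measurable_fun_xsection.
    by apply: measurableI; exact: measurable_thick_graph.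
  - by apply: measurable_funeM; apply/measurable_EFinP; exact: measurable_indic.
  move=> x _; rewrite indicE; have [Tx|Tx] := pselect (T (x - p.1)).
    rewrite mem_set// mule1 -(nu_centered (p.2 + gamma (x - p.1)) r0).
    apply: le_measure; rewrite ?inE.
    - apply: measurable_xsection.
      by apply: measurableI; exact: measurable_thick_graph.
    - rewrite (_ : [set y | _] = `[p.2 + gamma (x - p.1) - r, p.2 + gamma (x - p.1) + r]%classic).
        exact: measurable_itv.
      by apply/seteqP; split => y /=; rewrite in_itv/= ler_distl.
    - by move=> y; rewrite xsectionE /thick_graph/= opprD addrA => -[[]].
  rewrite memNset//= mule0 [X in nu X](_ : _ = set0) ?measure0//.
  apply/seteqP; split => // y; rewrite xsectionE => -[[/= Kp hp] [/= Kq hq]].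
  apply: Tx; split => //.
    by rewrite (_ : x - p.1 + (p.1 - q.1) = x - q.1)//; ring.
  rewrite (_ : x - p.1 + (p.1 - q.1) = x - q.1); last by ring.
  by move: hp hq; rewrite !ler_norml; lra.
rewrite ge0_integralZl//; last 2 first.
  by apply/measurable_EFinP; exact: measurable_indic.
  by rewrite lee_fin mulr_ge0.
rewrite integral_indic// setIT [X in (_ * X)%E](lebesgue_measure_shift p.1 mT).
apply: (@le_trans _ _ ((2 * r)%:E * (2 * (2 * r) / (eta * (p.1 - q.1)))%:E)%E).
  apply: lee_wpmul2l; first by rewrite lee_fin mulr_ge0.
  by apply: strip; rewrite ?mulr_ge0.
rewrite -EFinM lee_fin le_eqVlt; apply/orP; left; apply/eqP; ring.
Qed.

Lemma thick_graph_overlap r p q : 0 <= r -> p.1 != q.1 ->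
  ((nu \x nu)%E (thick_graph r p `&` thick_graph r q)
    <= (8 * r ^+ 2 / (eta * `|p.1 - q.1|))%:E)%E.
Proof.
move=> r0; case: (ltgtP p.1 q.1) => // pq _.
  by rewrite setIC distrC gtr0_norm ?subr_gt0//; exact: strip_overlap.
by rewrite gtr0_norm ?subr_gt0//; exact: strip_overlap.
Qed.

End ThickGraphs.

(** * Discrete energy *)

Section Energy.
Variable R : realType.
Implicit Types (p q : R * R) (d : R).

Definition sup_dist p q : R := Num.max `|p.1 - q.1| `|p.2 - q.2|.

(** Comparable to [1 / max d (2 ^- n)] for bounded [d]; in this form,
    sums against weights only involve the loads of dyadic squares. *)
Definition dyadic_kernel n d : R :=
  1 + \sum_(j < n.+1) 2 ^+ j * (d <= 2 ^- j)%R%:R.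

Lemma dyadic_kernel_ge1 n d : 1 <= dyadic_kernel n d.
Proof.
rewrite lerDl; apply: sumr_ge0 => j _.
by rewrite mulr_ge0// exprn_ge0.
Qed.

Lemma dyadic_kernel_small n d : d <= 2 ^- n -> 2 ^+ n <= dyadic_kernel n d.
Proof.
move=> dn; rewrite /dyadic_kernel big_ord_recr/= dn mulr1 addrA lerDr.
rewrite addr_ge0//; apply: sumr_ge0 => j _.
by rewrite mulr_ge0// exprn_ge0.
Qed.

Lemma inv_le_dyadic_kernel n d : 2 ^- n < d -> d^-1 <= 2 * dyadic_kernel n d.
Proof.
elim: n => [|n IH].
  rewrite expr0 invr1 => d1; have d0 : 0 < d by lra.
  have := dyadic_kernel_ge1 0 d.
  have : d^-1 <= 1 by rewrite invf_le1// ltW.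
  by lra.
have [dn nd|/IH{}IH _] := leP d (2 ^- n); last first.
  apply: le_trans IH _; rewrite ler_wpM2l// /dyadic_kernel lerD2l.
  by rewrite [leRHS]big_ord_recr/= lerDl mulr_ge0// exprn_ge0.
have h := dyadic_kernel_small dn.
have d0 : 0 < d by apply: le_lt_trans nd; rewrite invr_ge0 exprn_ge0.
have : d^-1 <= 2 ^+ n.+1.
  by rewrite -(invrK (2 ^+ n.+1)) lef_pV2 ?posrE ?invr_gt0 ?exprn_gt0// ltW.
rewrite exprS => h2; apply: le_trans h2 _; rewrite ler_wpM2l//.
apply: le_trans h _; rewrite /dyadic_kernel lerD2l.
by rewrite [leRHS]big_ord_recr/= lerDl mulr_ge0// exprn_ge0.
Qed.

Lemma floor_near (x y : R) : `|x - y| <= 1 ->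
  exists k : 'I_3, Num.floor y = Num.floor x + k%:Z - 1.
Proof.
rewrite ler_norml => /andP[h1 h2].
have := floor_itv x; have := floor_itv y.
set m := Num.floor y; set l := Num.floor x => /andP[y1 y2] /andP[x1 x2].
have lm : l - 1 <= m by rewrite /m floor_ge_int intrD/= rmorphN/=; lra.
have ml : m <= l + 1.
  have : (m%:~R : R) < (l + 1 + 1)%:~R by rewrite intrD; lra.
  by rewrite ltr_int; lia.
have h : (absz (m - l + 1)%R < 3)%N by lia.
by exists (Ordinal h) => /=; lia.
Qed.

Variables (I : finType) (pt : I -> R * R) (w : I -> R) (n : nat) (beta : R).
Hypothesis w0 : forall i, 0 <= w i.
Hypothesis beta0 : 0 <= beta.
Hypothesis beta2 : 2 * beta < 1.
Hypothesis w_cell : forall j t, (j <= n)%N ->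
  \sum_(q | dyadic_cell j (pt q) == t) w q <= beta ^+ j.

Let W := \sum_i w i.

(** A ball of radius [2 ^- j] meets at most nine squares of side [2 ^- j]. *)
Lemma near_load j i : (j <= n)%N ->
  \sum_q w q * (sup_dist (pt i) (pt q) <= 2 ^- j)%R%:R <= 9 * beta ^+ j.
Proof.
move=> jn; have j0 : (0 : R) < 2 ^+ j by rewrite exprn_gt0.
pose t (k : 'I_3 * 'I_3) : int * int :=
  (Num.floor (2 ^+ j * (pt i).1) + k.1%:Z - 1,
   Num.floor (2 ^+ j * (pt i).2) + k.2%:Z - 1).
apply: (@le_trans _ _ (\sum_q \sum_k (if dyadic_cell j (pt q) == t k then w q else 0))).
  apply: ler_sum => q _.
  have s0 (P : pred ('I_3 * 'I_3)) : 0 <= \sum_(k | P k) (if dyadic_cell j (pt q) == t k then w q else 0).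
    by apply: sumr_ge0 => k _; case: ifP.
  have [h|_] := boolP (sup_dist (pt i) (pt q) <= 2 ^- j); last by rewrite mulr0.
  have coord (x y : R) : `|x - y| <= 2 ^- j -> `|2 ^+ j * x - 2 ^+ j * y| <= 1.
    by rewrite -mulrBr normrM gtr0_norm// -ler_pdivlMl// mulr1.
  move: h; rewrite ge_max => /andP[/coord/floor_near[k1 e1] /coord/floor_near[k2 e2]].
  rewrite (bigD1 (k1, k2))//= ifT ?mulr1 ?lerDl//.
  by rewrite /dyadic_cell /t e1 e2.
rewrite exchange_big/=.
apply: (@le_trans _ _ (\sum_(k : 'I_3 * 'I_3) beta ^+ j)).
  by apply: ler_sum => k _; rewrite -big_mkcond/=; exact: w_cell.
by rewrite sumr_const card_prod !card_ord mulr_natl.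
Qed.

(** Finiteness of the energy of dimension one, uniformly in the scale: the
    condition [2 * beta < 1], which says that the exponent [s] exceeds
    [1], makes the geometric series over the scales converge. *)
Lemma dyadic_energy_le :
  \sum_i \sum_q w i * w q * dyadic_kernel n (sup_dist (pt i) (pt q)) <=
  W * (W + 9 / (1 - 2 * beta)).
Proof.
rewrite {1}/W mulr_suml; apply: ler_sum => i _.
under eq_bigr do rewrite -mulrA; rewrite -mulr_sumr.
apply: ler_wpM2l => //.
under eq_bigr do rewrite /dyadic_kernel mulrDr mulr1 mulr_sumr.
rewrite big_split/= lerD2l exchange_big/=.
apply: (@le_trans _ _ (\sum_(j < n.+1) 9 * (2 * beta) ^+ j)).
  apply: ler_sum => j _; under eq_bigr do rewrite mulrCA.
  rewrite -mulr_sumr exprMn mulrCA; apply: ler_wpM2l; first by rewrite exprn_ge0.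
  by apply: near_load; rewrite -ltnS.
rewrite -mulr_sumr; apply: ler_wpM2l => //.
have b1 : 0 < 1 - 2 * beta by rewrite subr_gt0.
rewrite -[leRHS]mul1r ler_pdivlMr// mulrC -opprB mulNr -subrX1 opprB.
by rewrite gerBl exprn_ge0// mulr_ge0.
Qed.

End Energy.

(** * Sums of positive measure *)

Section PositiveMeasure.
Variable R : realType.
Local Notation nu := (@lebesgue_measure R).
Local Notation mR := (measurableTypeR R).

(** Monotonicity of the product measure, for a larger set of which only the
    sections are known to be measurable. *)
Lemma le_product_measure (D F : set (mR * mR)) : measurable D ->
  (forall x, measurable (xsection F x)) -> D `<=` F ->
  ((nu \x nu) D <= (nu \x nu) F)%E.
Proof.
move=> mD mF DF; rewrite /product_measure1/=.
rewrite !ge0_integralTE//; apply: le_ereal_sup => _ [h hD <-]; exists h => //= x.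
apply: le_trans (hD x) _; apply: le_measure; rewrite ?inE//.
  exact: measurable_xsection.
by move=> y; rewrite !xsectionE; exact: DF.
Qed.

Lemma measurable_xsection_closed (F : set (R * R)) (x : R) : closed F ->
  measurable (xsection F x : set mR).
Proof.
move=> cF; apply: closed_measurable.
rewrite (_ : xsection F x = (fun y => (x, y)) @^-1` F); last first.
  by apply/seteqP; split => y /=; rewrite xsectionE.
apply: preimage_closed => // y _.
apply: (@cvg_pair _ _ _ (nbhs y) (nbhs x) (nbhs y)); [exact: cvg_cst|exact: cvg_id].
Qed.

(** Only three properties of the curve are used from here on: the Lipschitz
    bound, the positive measure of [K], and the estimate of level strips that
    expresses curvature. *)
Variables (gamma : R -> R) (L eta : R) (K : set R).
Hypothesis L0 : 0 <= L.
Hypothesis gamma_lip : forall s t, `|gamma s - gamma t| <= L * `|s - t|.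
Hypothesis compactK : compact K.
Hypothesis K_gt0 : (0 < nu K)%E.
Hypothesis eta0 : 0 < eta.
Hypothesis strip : forall h v r, 0 < h -> 0 <= r ->
  (nu (level_strip gamma K h v r) <= (2 * r / (eta * h))%:E)%E.

Lemma lipschitz_continuous : continuous gamma.
Proof.
move=> t; apply/cvgrPdist_le => e e0.
have L1 : 0 < L + 1 by rewrite ltr_wpDl.
near=> s; apply: le_trans (gamma_lip _ _) _.
have : `|t - s| <= e / (L + 1).
  near: s; have /cvgrPdist_le := @cvg_id _ (nbhs t); apply.
  by rewrite divr_gt0.
rewrite ler_pdivlMr// mulrDr mulr1 mulrC; apply: le_trans.
by rewrite lerDl.
Unshelve. all: by end_near. Qed.

Let gamma_cont := lipschitz_continuous.

Variables (E : set (R * R)) (s : R).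
Hypothesis compactE : compact E.
Hypothesis s1 : 1 < s.
Hypothesis E_s : hausdorff_measure s E != 0%E.

Let mtg := measurable_thick_graph gamma_cont compactK.

Let box : exists2 Q : R, 0 < Q & forall r p, r <= 1 -> E p ->
  thick_graph gamma K r p `<=` `[- Q, Q]%classic `*` `[- Q, Q]%classic.
Proof.
have [M M0 EM] := ex_strict_bound_gt0 (compact_bounded compactE).
have [M' M'0 KM] := ex_strict_bound_gt0 (compact_bounded compactK).
exists (M + M' + `|gamma 0| + L * M' + 1).
  by have := normr_ge0 (gamma 0); have := mulr_ge0 L0 (ltW M'0); lra.
move=> r p r1 Ep.
suff key (x y : R) : K (x - p.1) -> `|y - p.2 - gamma (x - p.1)| <= r ->
    `|x| <= M + M' + `|gamma 0| + L * M' + 1 /\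
    `|y| <= M + M' + `|gamma 0| + L * M' + 1.
  move=> z [Kz gz]; have [] := key _ _ Kz gz; rewrite !ler_norml => h1 h2.
  by split; rewrite /= in_itv/=.
move=> Kx gy.
have /= := EM _ Ep; rewrite prod_normE/= gt_max => /andP[p1 p2].
have /= t1 := KM _ Kx.
have g1 : `|gamma (x - p.1)| <= `|gamma 0| + L * M'.
  rewrite -[gamma (x - p.1)](subrK (gamma 0)) addrC.
  apply: le_trans (ler_normD _ _) _; rewrite lerD2l.
  by apply: le_trans (gamma_lip _ _) _; rewrite subr0 ler_wpM2l// ltW.
have LM : 0 <= L * M' by rewrite mulr_ge0// ltW.
have g0 := normr_ge0 (gamma 0).
move: p1 p2 t1 g1 gy; rewrite !ltr_norml !ler_norml.
move=> /andP[? ?] /andP[? ?] /andP[? ?] /andP[? ?] /andP[? ?].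
by split; apply/andP; split; lra.
Qed.

Let kappa := fine (nu K).

Let K_fin : nu K \is a fin_num.
Proof.
have [M M0 KM] := ex_strict_bound_gt0 (compact_bounded compactK).
rewrite ge0_fin_numE//; apply: (@le_lt_trans _ _ (nu `[- M, M]%classic)).
  apply: le_measure; rewrite ?inE.
  - exact: compact_measurable.
  - exact: measurable_itv.
  - by move=> t /KM /=; rewrite ltr_norml in_itv/= => /andP[/ltW -> /ltW ->].
by rewrite lebesgue_measure_itv/=; case: ifP => // _; rewrite -EFinB ltry.
Qed.

Let kappa0 : 0 < kappa.
Proof. by rewrite fine_gt0// K_gt0 -ge0_fin_numE. Qed.

(** The overlap of two thickened translates decays like the inverse distance
    of the translation vectors. The thickness is a quarter of the scale, so
    that when the vectors are further apart than the scale, an overlap forces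
    their horizontal distance to be comparable to their distance. *)
Lemma thick_graph_overlap_kernel n p q :
  ((nu \x nu) (thick_graph gamma K (2 ^- n / 4) p `&`
               thick_graph gamma K (2 ^- n / 4) q) <=
   ((kappa / 2 + 2 * (L + 1) / eta) * (2 ^- n) ^+ 2 *
     dyadic_kernel n (sup_dist p q))%:E)%E.
Proof.
set del : R := 2 ^- n; set d := sup_dist p q.
have del0 : 0 < del by rewrite invr_gt0 exprn_gt0.
have r0 : 0 <= del / 4 by rewrite divr_ge0// ltW.
have k1 := dyadic_kernel_ge1 n d.
set kk := dyadic_kernel n d in k1 *.
have Le : 0 <= 2 * (L + 1) / eta.
  by rewrite divr_ge0 ?(ltW eta0)// mulr_ge0// addr_ge0.
have dk : 0 <= del ^+ 2 * kk by rewrite mulr_ge0 ?sqr_ge0//; lra.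
have [dn|nd] := leP d del.
  apply: (@le_trans _ _ ((nu \x nu)%E (thick_graph gamma K (del / 4) p))).
    apply: le_measure; rewrite ?inE; [apply: measurableI|exact: mtg|exact: subIsetl];
      exact: mtg.
  rewrite measure_thick_graph// -(fineK K_fin) -/kappa -EFinM lee_fin.
  have h : del <= del ^+ 2 * kk.
    have := dyadic_kernel_small dn; rewrite -/kk -(ler_pM2l del0) => h.
    rewrite -[leLHS]mulr1 expr2 -mulrA ler_wpM2l ?(ltW del0)//.
    by apply: le_trans h; rewrite /del mulVf// expf_neq0.
  have h2 : kappa / 2 * del <= kappa / 2 * (del ^+ 2 * kk).
    by rewrite ler_wpM2l// divr_ge0// ltW.
  have h3 : 0 <= 2 * (L + 1) / eta * (del ^+ 2 * kk) by rewrite mulr_ge0.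
  lra.
have [->|/set0P ne] := eqVneq (thick_graph gamma K (del / 4) p `&`
    thick_graph gamma K (del / 4) q) set0.
  rewrite measure0 lee_fin -mulrA mulr_ge0// addr_ge0// divr_ge0// ltW//.
have := thick_graph_disjoint L0 gamma_lip ne.
set h := `|p.1 - q.1| => h1.
have h_ge0 : 0 <= h := normr_ge0 _.
have d0 : 0 < d by apply: lt_trans nd.
have dh : d <= 2 * (L + 1) * h.
  have Lh : 0 <= L * h by rewrite mulr_ge0.
  by move: h1 nd; rewrite /d /sup_dist -/h; case: (leP h) => ?; lra.
have h0 : 0 < h.
  rewrite lt_neqAle h_ge0 andbT eq_sym; apply/eqP => hE.
  by move: dh; rewrite hE mulr0; lra.
have pq : p.1 != q.1 by rewrite -subr_eq0 -normr_eq0 gt_eqF.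
have ov := thick_graph_overlap gamma_cont compactK strip r0 pq.
apply: (le_trans ov).
rewrite lee_fin -/h.
have h2 : h^-1 <= 2 * (L + 1) * (2 * kk).
  apply: (@le_trans _ _ (2 * (L + 1) * d^-1)).
    rewrite ler_pdivlMr// mulrC ler_pdivrMr// mulrC//.
  by rewrite ler_wpM2l ?inv_le_dyadic_kernel// mulr_ge0// addr_ge0.
have -> : 8 * (del / 4) ^+ 2 / (eta * h) = del ^+ 2 / (2 * eta) * h^-1.
  by field; rewrite !gt_eqF.
have h3 : del ^+ 2 / (2 * eta) * h^-1 <=
    del ^+ 2 / (2 * eta) * (2 * (L + 1) * (2 * kk)).
  by rewrite ler_wpM2l// divr_ge0 ?sqr_ge0// mulr_ge0// ltW.
apply: le_trans h3 _.
have -> : del ^+ 2 / (2 * eta) * (2 * (L + 1) * (2 * kk)) =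
    2 * (L + 1) / eta * (del ^+ 2 * kk) by field; rewrite gt_eqF.
by rewrite -[leRHS]mulrA ler_wpM2r// lerDr divr_ge0// ltW.
Qed.

Let box_fin (A : set (mR * mR)) (Q : R) : 0 < Q -> measurable A ->
  A `<=` `[- Q, Q]%classic `*` `[- Q, Q]%classic -> ((nu \x nu) A < +oo)%E.
Proof.
move=> Q0 mA sA.
apply: (@le_lt_trans _ _ ((nu \x nu)%E (`[- Q, Q]%classic `*` `[- Q, Q]%classic))).
  by apply: le_measure; rewrite ?inE//; apply: measurableX; exact: measurable_itv.
rewrite product_measure1E; [|exact: measurable_itv|exact: measurable_itv].
have nQ : nu `[- Q, Q]%classic = (2 * Q)%:E.
  rewrite lebesgue_measure_itv/= lte_fin ifT; last by lra.
  by rewrite -EFinB; congr EFin; ring.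
rewrite [ltLHS](_ : _ = ((2 * Q) * (2 * Q))%:E) ?ltry//.
by rewrite EFinM; congr (_ * _)%E; exact: nQ.
Qed.

(** Apply the second moment bound to the thickened translates by the points of
    a discrete Frostman weight: the sum of the measures is of order
    [W * del], that of the overlaps at most of order
    [del ^+ 2 * W * (W + C')], and the quotient of the square of the
    first by the second is bounded below because the total weight [W] is. *)
Lemma thick_union_ge : exists2 c : R, 0 < c & forall n : nat,
  exists V : set (mR * mR), [/\ measurable V, (c%:E <= (nu \x nu) V)%E &
    forall z, V z -> exists2 p, E p & thick_graph gamma K (2 ^- n / 4) p z].
Proof.
have s0 : 0 < s by have := s1; lra.
have [c0 c00 frost] := discrete_frostman compactE s0 E_s.
have [Q Q0 boxQ] := box.
set beta : R := 2 `^ (- s) in frost.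
have beta0 : 0 <= beta by exact: powR_ge0.
have beta2 : 2 * beta < 1.
  have -> : beta = 2^-1 `^ s by rewrite /beta -powR_inv1// -powRrM mulN1r.
  by rewrite mulrC -ltr_pdivlMr// mul1r powR_half_lt.
pose C := kappa / 2 + 2 * (L + 1) / eta.
have C0 : 0 < C.
  rewrite ltr_pwDl ?divr_gt0// divr_ge0 ?(ltW eta0)// mulr_ge0// addr_ge0//.
pose C' := 9 / (1 - 2 * beta).
have C'0 : 0 <= C' by rewrite divr_ge0// subr_ge0 ltW.
exists (kappa ^+ 2 * c0 / (4 * C * (c0 + C'))).
  by rewrite divr_gt0 ?mulr_gt0 ?exprn_gt0// ltr_pwDl.
move=> n; have [I [pt [w [ptE w0 wc wc0]]]] := frost n.
set del : R := 2 ^- n; set W := \sum_i w i in wc0.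
have del0 : 0 < del by rewrite invr_gt0 exprn_gt0.
have del1 : del / 4 <= 1.
  have : del <= 1 by rewrite invf_le1 ?exprn_gt0// exprn_ege1// ler1n.
  by lra.
have r0 : 0 <= del / 4 by rewrite divr_ge0// ltW.
have W0 : 0 < W by apply: lt_le_trans wc0.
pose A i := thick_graph gamma K (del / 4) (pt i).
have mA i : measurable (A i) by exact: mtg.
pose V := \bigcup_(i in [set: I]) A i.
have mV : measurable V by apply: fin_bigcup_measurable => // i _; exact: mA.
have fV : ((nu \x nu) V < +oo)%E.
  by apply: (box_fin Q0) => // z [i _ Az]; exact: (boxQ _ _ del1 (ptE i)).
exists V; split => //; last by move=> z [i _ Az]; exists (pt i).
have AV i : A i `<=` V by move=> z Az; exists i.
pose M := W * (del * kappa / 2).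
have M0 : 0 < M by rewrite mulr_gt0// divr_gt0// mulr_gt0.
pose S := C * del ^+ 2 * (W * (W + C')).
have S0 : 0 < S.
  by rewrite mulr_gt0 ?mulr_gt0 ?exprn_gt0// ltr_pwDl.
have hM : M <= \sum_i w i * fine ((nu \x nu)%E (A i)).
  rewrite /M /W mulr_suml le_eqVlt; apply/orP; left; apply/eqP.
  apply: eq_bigr => i _; rewrite measure_thick_graph// -(fineK K_fin) -/kappa/=.
  by congr (_ * _); field.
have hS : \sum_i \sum_j w i * w j * fine ((nu \x nu)%E (A i `&` A j)) <= S.
  apply: (@le_trans _ _ (\sum_i \sum_j C * del ^+ 2 *
      (w i * w j * dyadic_kernel n (sup_dist (pt i) (pt j))))).
    apply: ler_sum => i _; apply: ler_sum => j _.
    rewrite [leRHS]mulrCA; apply: ler_wpM2l; first by rewrite mulr_ge0.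
    have := thick_graph_overlap_kernel n (pt i) (pt j).
    rewrite -/del -/C => h; rewrite -lee_fin fineK//.
    rewrite ge0_fin_numE//; apply: le_lt_trans h _; exact: ltry.
  under eq_bigr do rewrite -mulr_sumr.
  rewrite -mulr_sumr; apply: ler_wpM2l; first by rewrite mulr_ge0 ?sqr_ge0 ?ltW.
  exact: dyadic_energy_le.
apply: le_trans (measure_cover_ge mA mV AV fV M0 S0 hM hS).
rewrite lee_fin.
have -> : M ^+ 2 / S = kappa ^+ 2 * W / (4 * C * (W + C')).
  rewrite /M /S; field; rewrite !gt_eqF//= ?mulr_gt0//.
  by rewrite ltr_pwDl.
have e1 : 0 < c0 + C' by rewrite ltr_pwDl.
have e2 : 0 < W + C' by rewrite ltr_pwDl.
have k2 : 0 < kappa ^+ 2 / (4 * C) by rewrite divr_gt0 ?mulr_gt0 ?exprn_gt0.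
have -> : kappa ^+ 2 * c0 / (4 * C * (c0 + C')) =
  kappa ^+ 2 / (4 * C) * (c0 / (c0 + C')) by field; rewrite !gt_eqF.
have -> : kappa ^+ 2 * W / (4 * C * (W + C')) =
  kappa ^+ 2 / (4 * C) * (W / (W + C')) by field; rewrite !gt_eqF.
apply: ler_wpM2l; first exact: ltW.
rewrite ler_pdivrMr// mulrAC ler_pdivlMr//.
by have := ler_wpM2l C'0 wc0; lra.
Qed.

(** The upper limit of the thickened sets has measure bounded below and, as
    the thickness tends to [0], lies in every closed set that contains the
    translates. *)
Lemma plane_lebesgue_gt0 (F : set (R * R)) : closed F ->
  (forall p t, E p -> K t -> F (p.1 + t, p.2 + gamma t)) ->
  (0 < plane_lebesgue F)%E.
Proof.
move=> cF EKF; have [c c0 cV] := thick_union_ge.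
have [V VP] := choice cV.
have mV n : measurable (V n) by have [] := VP n.
pose D k := \bigcup_(n in [set n | (k <= n)%N]) V n.
have mD k : measurable (D k) by exact: bigcup_measurable.
have mDD : measurable (\bigcap_k D k) by exact: bigcap_measurable.
have DF : \bigcap_k D k `<=` F.
  suff key (z : R * R) : (\bigcap_k D k) z -> F z by exact: key.
  move=> Dz; apply: cF => B /nbhs_ballP[e /= e0 eB].
  have [k] := ltr_add_invr e0; rewrite add0r => ke.
  have [n /= kn Vz] := Dz k I.
  have [_ _ /(_ _ Vz)[p Ep [Kz gz]]] := VP n.
  exists (p.1 + (z.1 - p.1), p.2 + gamma (z.1 - p.1)); split; first exact: EKF.
  apply: eB; split; rewrite /= /ball/=.
    by rewrite subrKC subrr normr0.
  rewrite opprD addrA; apply: le_lt_trans gz _; apply: le_lt_trans ke.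
  apply: (@le_trans _ _ (2 ^- n)); first by rewrite ler_piMr// ?invr_ge0 ?exprn_ge0// invf_le1// ler1n.
  rewrite lef_pV2 ?posrE ?exprn_gt0// -natrX ler_nat.
  by apply: leq_ltn_trans kn _; exact: ltn_expl.
apply: (@lt_le_trans _ _ c%:E); first by rewrite lte_fin.
apply: (@le_trans _ _ ((nu \x nu)%E (\bigcap_k D k))); last first.
  apply: le_product_measure => // x.
  exact: measurable_xsection_closed.
have [Q Q0 boxQ] := box.
have D_fin : ((nu \x nu) (D 0%N) < +oo)%E.
  apply: (box_fin Q0) => // z [n _ Vz].
  have [_ _ /(_ _ Vz)[p Ep]] := VP n; apply: boxQ => //.
  have : (2 : R) ^- n <= 1 by rewrite invf_le1 ?exprn_gt0// exprn_ege1// ler1n.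
  by lra.
have D_ni : nonincreasing_seq D.
  move=> i j ij; apply/subsetPset => z [n /= jn Vz]; exists n => //=.
  exact: leq_trans jn.
have cvgD := nonincreasing_cvg_mu D_fin mD mDD D_ni.
rewrite -(cvg_lim _ cvgD)//; apply: lime_ge; first by apply/cvg_ex; eexists; exact: cvgD.
near=> k; have [_ h _] := VP k; apply: le_trans h _ => /=.
by apply: le_measure; rewrite ?inE// => z Vz; exists k => //=.
Unshelve. all: by end_near. Qed.

End PositiveMeasure.

Section UpperBound.
Variables (R : realType) (a b : R).

(** Nearest point of the interval. Since [gamma] is arbitrary outside the
    interval, composing it with [clamp] gives the continuous function on the
    line that the measurability arguments need. *)
Definition clamp (t : R) : R := Num.max a (Num.min t b).

Lemma clamp_id t : a <= t -> t <= b -> clamp t = t.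
Proof. by move=> a_t tb; rewrite /clamp min_l// max_r. Qed.

Lemma clamp_in t : a <= b -> a <= clamp t /\ clamp t <= b.
Proof. by move=> ab; rewrite /clamp le_max lexx ge_max ab ge_min lexx orbT. Qed.

Lemma clamp_dist s t : a <= b -> `|clamp s - clamp t| <= `|s - t|.
Proof.
move=> ab; rewrite /clamp.
have := ler_norm (s - t); have := ler_norm (t - s); rewrite (distrC t) ler_norml.
by case: (leP s b) => ?; case: (leP t b) => ?;
  [case: (leP a s) => ?; case: (leP a t) => ?
  |case: (leP a s) => ?; case: (leP a b) => ?
  |case: (leP a b) => ?; case: (leP a t) => ?
  |case: (leP a b) => ?]; lra.
Qed.

Variable gamma : R -> R.
Hypothesis ab : a < b.

Lemma lipschitz_extension : [lipschitz gamma x | x in `[a, b]] ->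
  exists2 L : R, 0 <= L & forall s t,
    `|gamma (clamp s) - gamma (clamp t)| <= L * `|s - t|.
Proof.
move=> /pinfty_ex_gt0[L L0 lip]; exists L; first exact: ltW.
move=> s t; have [s1 s2] := clamp_in s (ltW ab); have [t1 t2] := clamp_in t (ltW ab).
have := lip (clamp s, clamp t); rewrite /self_sub/= !in_itv/= s1 s2 t1 t2.
move=> /(_ (conj isT isT)) h; apply: le_trans h _.
by rewrite ler_wpM2l ?clamp_dist ?ltW.
Qed.

Lemma compact_minkowski_sum_graph (E : set (R * R)) (gam : R -> R) :
  compact E -> continuous gam -> {in `[a, b], gamma =1 gam} ->
  compact (minkowski_sum E (graph_on a b gamma)).
Proof.
move=> cE cg gE.
have -> : minkowski_sum E (graph_on a b gamma) =
    (fun z : (R * R) * R => (z.1.1 + z.2, z.1.2 + gam z.2)) @` (E `*` `[a, b]%classic).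
  apply/seteqP; split => [_ [p Ep [_ [t tab <-] <-]]|_ [[p t] [Ep tab] <-]].
    by exists (p, t) => //=; rewrite -gE.
  by exists p => //; exists (t, gamma t); [exists t|rewrite /= gE].
apply: continuous_compact; last by apply: compact_setX => //; exact: segment_compact.
apply: continuous_subspaceT => z.
apply: (@cvg_pair _ _ _ (nbhs z) (nbhs (z.1.1 + z.2)) (nbhs (z.1.2 + gam z.2))).
  apply: cvgD; last exact: cvg_snd.
  by apply: (@cvg_comp _ _ _ fst fst _ (nbhs z.1)); exact: cvg_fst.
apply: cvgD.
  by apply: (@cvg_comp _ _ _ fst snd _ (nbhs z.1)); [exact: cvg_fst|exact: cvg_snd].
by apply: (@cvg_comp _ _ _ snd gam _ (nbhs z.2)); [exact: cvg_snd|exact: cg].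
Qed.

Variable k : R -> R.
Variable D2gamma : {finite_measure set (measurableTypeR R) -> \bar R}.
Variable kappa_s : {measure set (measurableTypeR R) -> \bar R}.
Hypothesis gamma_convex : convex_function `[a, b] gamma.
Hypothesis gamma_lipschitz : [lipschitz gamma x | x in `[a, b]].
Hypothesis D2gammaP : is_D2 a b gamma D2gamma.
Hypothesis decomposition : lebesgue_decomposition a b D2gamma k kappa_s.
Hypothesis k_pos :
  (0 < lebesgue_measure (`]a, b[ `&` [set x | (0 < k x)%R]))%E.

Local Notation nu := (@lebesgue_measure R).
Let g := right_derivative gamma.

Let g_nd s t : a < s -> s <= t -> t < b -> g s <= g t.
Proof. by move=> a_s st tb; apply: (right_derivative_nondecreasing gamma_convex). Qed.

(** The singular part only helps: on a set where [k] is at least [c], the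
    second derivative dominates [c] times Lebesgue measure. *)
Let curvature_set : exists (B : set (measurableTypeR R)) (c : R),
  [/\ measurable B, B `<=` `]a, b[, (0 < nu B)%E, 0 < c &
    forall A : set (measurableTypeR R), measurable A -> A `<=` `]a, b[ ->
      (c%:E * nu (A `&` B) <= D2gamma A)%E].
Proof.
have [ik _ muE] := decomposition.
have mab : measurable (`]a, b[%classic : set (measurableTypeR R)).
  exact: measurable_itv.
have mk : measurable_fun (`]a, b[%classic : set (measurableTypeR R)) k.
  by apply/measurable_EFinP; case/integrableP: ik.
have [c c0 Bc] := superlevel_set_gt0 mab mk k_pos.
set B := _ `&` _ in Bc; exists B, c.
have mB : measurable B.
  rewrite /B (_ : [set x | _] = k @^-1` `[c, +oo[).
    by apply: mk => //; exact: measurable_itv.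
  by apply/seteqP; split => x /=; rewrite in_itv/= andbT.
split => //; first by move=> x [].
move=> A mA Aab.
have mAB : measurable (A `&` B) by exact: measurableI.
have ABab : A `&` B `<=` `]a, b[ by move=> x [_ []].
apply: (@le_trans _ _ (D2gamma (A `&` B))); last first.
  by apply: le_measure; rewrite ?inE//; exact: subIsetl.
rewrite muE//; apply: (@le_trans _ _ (\int[nu]_(x in A `&` B) (k x)%:E)%E); last first.
  by rewrite leeDl.
rewrite -integral_cst//; apply: ge0_le_integral => //.
- by move=> x _; rewrite lee_fin ltW.
- by apply/measurable_EFinP; apply: measurable_funS mk.
- by move=> x [_ [_ /=]]; rewrite lee_fin.
Qed.

(** Some set of positive measure on which [k >= c] gives, by density, a
    compact [K] on which the right derivative grows at least linearly, and
    hence the estimate of level strips. *)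
Lemma sum_with_curve_gt0 (E : set (R * R)) : compact E ->
  (1%:E < hausdorff_dim E)%E ->
  (0 < plane_lebesgue (minkowski_sum E (graph_on a b gamma)))%E.
Proof.
move=> cE /(hausdorff_dim_gt ler01)[s s1 sE].
have [B [c [mB Bab B0 c0 Bmu]]] := curvature_set.
have [K [eta [cK Kab K0 eta0 Keta]]] := density_compact mB Bab B0.
have [L L0 lip] := lipschitz_extension gamma_lipschitz.
pose gam t := gamma (clamp t).
have gamE t : a <= t -> t <= b -> gam t = gamma t.
  by move=> h1 h2; rewrite /gam clamp_id.
have cgam : continuous gam := lipschitz_continuous L0 lip.
have g_le s' t : a < s' -> s' < t -> t < b -> g s' * (t - s') <= gam t - gam s'.
  move=> h1 h2 h3; rewrite !gamE; [|lra|lra|lra|lra].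
  by apply: (right_derivative_le gamma_convex); lra.
have g_ge s' t : a < s' -> s' < t -> t < b -> gam t - gam s' <= g t * (t - s').
  move=> h1 h2 h3; rewrite !gamE; [|lra|lra|lra|lra].
  by apply: (right_derivative_ge gamma_convex); lra.
have K_growth x y : K x -> x < y -> y < b -> c * eta * (y - x) <= g y - g x.
  move=> Kx xy yb; have /= := Kab _ Kx; rewrite in_itv/= => /andP[ax _].
  apply: le_trans (D2_lower_bound g_nd D2gammaP mB c0 Bmu ax xy yb).
  by rewrite -mulrA; apply: ler_wpM2l; [exact: ltW|exact: Keta].
have ce0 : 0 < c * eta by rewrite mulr_gt0.
have strip h v r (h0 : 0 < h) (r0 : 0 <= r) :=
  measure_level_strip g_le g_ge g_nd ce0 cK Kab K_growth cgam v h0 r0.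
apply: (plane_lebesgue_gt0 L0 lip cK K0 ce0 strip cE s1 sE).
  apply: compact_closed => //.
  apply: (compact_minkowski_sum_graph cE cgam) => t; rewrite in_itv/= => /andP[h1 h2].
  by rewrite gamE.
move=> p t Ep Kt; have /= := Kab _ Kt; rewrite in_itv/= => /andP[h1 h2].
exists p => //; exists (t, gamma t); last by rewrite -gamE ?ltW.
by exists t => //=; rewrite in_itv/= !ltW.
Qed.

End UpperBound.

(** * Cantor sets *)

Section DigitExpansions.
Variable R : realType.
Implicit Types (d e : nat -> bool) (x y : R).

(** A sequence of binary digits read in base [1 / x]. *)
Definition digit_value x d : R := limn (series (fun i => (d i)%:R * x ^+ i)).

Lemma is_cvg_digits x d : 0 < x -> x < 1 -> cvgn (series (fun i => (d i)%:R * x ^+ i)).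
Proof.
move=> x0 x1; apply: (@series_le_cvg _ _ (geometric 1 x)).
- by move=> i; rewrite mulr_ge0 ?ler0n ?exprn_ge0 ?ltW.
- by move=> i; rewrite /= mul1r exprn_ge0 ?ltW.
- by move=> i; rewrite /= ler_wpM2r ?exprn_ge0 ?(ltW x0)//; case: (d i).
- by apply: is_cvg_geometric_series; rewrite gtr0_norm.
Qed.

Lemma digit_value_ge0 x d : 0 < x -> x < 1 -> 0 <= digit_value x d.
Proof.
move=> x0 x1; apply: limr_ge; first exact: is_cvg_digits.
near=> n; apply: sumr_ge0 => i _; rewrite mulr_ge0 ?ler0n ?exprn_ge0 ?ltW.
Unshelve. all: by end_near. Qed.

Lemma digit_value_le x d : 0 < x -> x < 1 -> digit_value x d <= (1 - x)^-1.
Proof.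
move=> x0 x1; apply: limr_le; first exact: is_cvg_digits.
near=> n; have := @geometric_le_lim _ n 1 x ler01 x0.
rewrite gtr0_norm// mul1r => /(_ x1); apply: le_trans.
apply: ler_sum => i _; rewrite /= ler_wpM2r ?exprn_ge0 ?(ltW x0)//.
by case: (d i).
Unshelve. all: by end_near. Qed.

Lemma digit_valueS x d : 0 < x -> x < 1 ->
  digit_value x d = (d 0%N)%:R + x * digit_value x (fun i => d i.+1).
Proof.
move=> x0 x1; apply: cvg_lim => //.
rewrite -cvg_shiftS /=.
have -> : (fun n => series (fun i => (d i)%:R * x ^+ i) n.+1) =
    (fun n => (d 0%N)%:R + x * series (fun i => (d i.+1)%:R * x ^+ i) n).
  apply/funext => n; rewrite /series/= big_nat_recl//= expr0 mulr1; congr (_ + _).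
  by rewrite mulr_sumr; apply: eq_bigr => i _; rewrite exprS mulrCA.
apply: cvgD; first exact: cvg_cst.
apply: cvgM; first exact: cvg_cst.
exact: is_cvg_digits.
Qed.

Lemma digit_value_agree n x d e : 0 < x -> x < 1 ->
  (forall i, (i < n)%N -> d i = e i) ->
  digit_value x d - digit_value x e =
  x ^+ n * (digit_value x (fun i => d (n + i)%N) - digit_value x (fun i => e (n + i)%N)).
Proof.
move=> x0 x1; elim: n d e => [|n IH] d e de; first by rewrite expr0 mul1r.
rewrite (digit_valueS d x0 x1) (digit_valueS e x0 x1) de// [_ + x * _]addrC addrKA -mulrBr (IH (fun i => d i.+1) (fun i => e i.+1)); last first.
  by move=> i ni; apply: de.
by rewrite exprS mulrA.
Qed.

Lemma digit_value_dist_le n x d e : 0 < x -> x < 1 ->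
  (forall i, (i < n)%N -> d i = e i) ->
  `|digit_value x d - digit_value x e| <= x ^+ n / (1 - x).
Proof.
move=> x0 x1 /(digit_value_agree x0 x1) ->.
rewrite normrM ger0_norm ?exprn_ge0 ?(ltW x0)//; apply: ler_wpM2l.
  by rewrite exprn_ge0 ?ltW.
set u := digit_value _ _; set v := digit_value _ _.
have u0 : 0 <= u := digit_value_ge0 _ x0 x1.
have v0 : 0 <= v := digit_value_ge0 _ x0 x1.
have u1 : u <= (1 - x)^-1 := digit_value_le _ x0 x1.
have v1 : v <= (1 - x)^-1 := digit_value_le _ x0 x1.
by rewrite ler_norml; lra.
Qed.

(** When [x] is less than one half, the first differing digit dominates all
    the later ones. *)
Lemma digit_value_dist_ge n x d e : 0 < x -> x < 2^-1 ->
  (forall i, (i < n)%N -> d i = e i) -> d n <> e n ->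
  x ^+ n * ((1 - 2 * x) / (1 - x)) <= `|digit_value x d - digit_value x e|.
Proof.
move=> x0 x12 de den.
have x1 : x < 1 by lra.
rewrite (digit_value_agree x0 x1 de) normrM ger0_norm ?exprn_ge0 ?(ltW x0)//.
apply: ler_wpM2l; first by rewrite exprn_ge0 ?ltW.
rewrite (digit_valueS (fun i => d (n + i)%N) x0 x1).
rewrite (digit_valueS (fun i => e (n + i)%N) x0 x1) addn0.
set u := digit_value _ _; set v := digit_value _ _.
have u0 : 0 <= u := digit_value_ge0 _ x0 x1.
have v0 : 0 <= v := digit_value_ge0 _ x0 x1.
have u1 : x * u <= x / (1 - x) by rewrite ler_wpM2l ?(ltW x0) ?digit_value_le.
have v1 : x * v <= x / (1 - x) by rewrite ler_wpM2l ?(ltW x0) ?digit_value_le.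
have -> : (1 - 2 * x) / (1 - x) = 1 - x / (1 - x) by field; lra.
have xu : 0 <= x * u by rewrite mulr_ge0// ltW.
have xv : 0 <= x * v by rewrite mulr_ge0// ltW.
case: (d n) (e n) den => -[]//= _.
  by apply: le_trans (ler_norm _); lra.
by rewrite distrC; apply: le_trans (ler_norm _); lra.
Qed.

(** Greedy binary digits; the values in base two fill the interval from [0] to
    [2] since the first digit has weight [1]. *)
Lemma binary_expansion y : 0 <= y -> y <= 2 -> exists d, digit_value 2^-1 d = y.
Proof.
move=> y0 y2.
pose next z : R := 2 * (z - (1 <= z)%R%:R).
pose d i := 1 <= iter i next y.
have next_in z : 0 <= z <= 2 -> 0 <= next z <= 2.
  by rewrite /next; case: (leP 1 z) => /= h; lra.
have it_in i : 0 <= iter i next y <= 2.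
  by elim: i => [|i IH]; [rewrite /= y0 y2|exact: next_in].
have h0 : (0 : R) < 2^-1 by rewrite invr_gt0.
have h1 : (2^-1 : R) < 1 by rewrite invf_lt1// ltr1n.
exists d.
have rest n : y - digit_value 2^-1 d =
    2^-1 ^+ n * (iter n next y - digit_value 2^-1 (fun i => d (n + i)%N)).
  elim: n => [|n IH]; first by rewrite expr0 mul1r.
  rewrite IH exprSr -mulrA; congr (_ * _).
  rewrite digit_valueS// addn0 /= /next -/(d n).
  have -> : (fun i => d (n + i.+1)%N) = (fun i => d (n.+1 + i)%N).
    by apply/funext => i; rewrite addSnnS.
  by field; rewrite ?expf_neq0.
suff : `|y - digit_value 2^-1 d| <= 0 by rewrite normr_le0 subr_eq0 => /eqP.
apply/ler_addgt0Pr => e e0; rewrite add0r.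
have e40 : 0 < e / 4 by rewrite divr_gt0.
have [m] := ltr_add_invr e40; rewrite add0r => ne.
rewrite (rest m) normrM ger0_norm ?exprn_ge0 ?(ltW h0)//.
have r4 : `|iter m next y - digit_value 2^-1 (fun i => d (m + i)%N)| <= 4.
  have := it_in m; have := @digit_value_ge0 2^-1 (fun i => d (m + i)%N) h0 h1.
  have := @digit_value_le 2^-1 (fun i => d (m + i)%N) h0 h1.
  have -> : (1 - 2^-1 : R)^-1 = 2 by field.
  by rewrite ler_norml; lra.
have l : (2^-1 : R) ^+ m <= e / 4.
  apply: le_trans (ltW ne); rewrite exprVn lef_pV2 ?posrE ?exprn_gt0//.
  by rewrite -natrX ler_nat; exact: ltn_expl.
have : 2^-1 ^+ m * `|iter m next y - digit_value 2^-1 (fun i => d (m + i)%N)| <= e / 4 * 4.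
  by apply: ler_pM => //; rewrite exprn_ge0 ?(ltW h0).
by rewrite divfK.
Qed.

End DigitExpansions.

Section CantorSet.
Variables (R : realType) (x : R).
Hypotheses (x0 : 0 < x) (x12 : x < 2^-1).
Local Notation nu := (@lebesgue_measure R).
Local Notation mR := (measurableTypeR R).

Let x1 : x < 1. Proof. by apply: lt_trans x12 _; rewrite invf_lt1// ltr1n. Qed.

(** The self-similar Cantor set of ratio [x]. *)
Definition cantor_set : set R := range (digit_value x).

Lemma digit_value_continuous : continuous (digit_value x : cantor_space -> R).
Proof.
move=> d; apply/cvgrPdist_le => e e0.
have c0 : 0 < e * (1 - x) by rewrite mulr_gt0// subr_gt0.
have [n nP] : exists n, x ^+ n <= e * (1 - x).
  have : geometric 1 x @ \oo --> 0 by apply: cvg_geometric; rewrite gtr0_norm.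
  move=> /cvgr0Pnorm_le/(_ _ c0)[n _ nP]; exists n.
  by have := nP n (leqnn n); rewrite /= mul1r; apply: le_trans; exact: ler_norm.
have near_n : nbhs (d : cantor_space)
    [set d' : cantor_space | forall i : 'I_n, (d' : nat -> bool) i = d i].
  have nd i : nbhs (d : cantor_space) [set d' : cantor_space | (d' : nat -> bool) i = d i].
    apply: (@proj_continuous nat (fun=> bool) i d [set b | b = d i]).
    by rewrite nbhs_principalE; apply/principal_filterP.
  exact: (@filter_forall cantor_space 'I_n
    (fun i (d' : cantor_space) => (d' : nat -> bool) i = d i)
    (nbhs (d : cantor_space)) (@nbhs_filter cantor_space d) (fun i => nd i)).
near=> d'; have h : forall i : 'I_n, (d' : nat -> bool) i = d i by near: d'.
apply: (@le_trans _ _ (x ^+ n / (1 - x))).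
  by apply: digit_value_dist_le => // i ni; rewrite (h (Ordinal ni)).
by rewrite ler_pdivrMr// subr_gt0.
Unshelve. all: by end_near. Qed.

Lemma compact_cantor_set : compact cantor_set.
Proof.
apply: (@continuous_compact _ _ (digit_value x : cantor_space -> R)).
  by apply: continuous_subspaceT; exact: digit_value_continuous.
exact: cantor_space_compact.
Qed.

Let piece (a r : R) : set R := [set a + r * digit_value x d | d in setT].

Let compact_piece a r : compact (piece a r).
Proof.
apply: (@continuous_compact _ _ (fun d : cantor_space => a + r * digit_value x d)).
  apply: continuous_subspaceT => d; apply: cvgD; first exact: cvg_cst.
  by apply: cvgM; [exact: cvg_cst|exact: digit_value_continuous].
exact: cantor_space_compact.
Qed.

Let mpiece a r : measurable (piece a r : set mR).
Proof. by apply: compact_measurable; exact: compact_piece. Qed.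

(** Splitting according to the first digit doubles the number of pieces and
    scales them by [x], so the total length of the covers decays like
    [(2 * x) ^+ n]. *)
Let piece_split a r : piece a r `<=` piece a (r * x) `|` piece (a + r) (r * x).
Proof.
move=> _ [d _ <-]; rewrite digit_valueS//.
case: (d 0%N); [right|left]; exists (fun i => d i.+1) => //=.
  by rewrite mulrDr mulr1 addrA mulrA.
by rewrite add0r mulrA.
Qed.

Let piece_measure n a r : 0 < r ->
  (nu (piece a r) <= ((2 * x) ^+ n * (r / (1 - x)))%:E)%E.
Proof.
have x1' : 0 < 1 - x by rewrite subr_gt0.
elim: n a r => [|n IH] a r r0.
  rewrite expr0 mul1r.
  have ne : 0 < r / (1 - x) by rewrite divr_gt0.
  have -> : (r / (1 - x))%:E = nu `[a, a + r / (1 - x)]%classic.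
    by rewrite lebesgue_measure_itv/= lte_fin ltrDl ne -EFinB addrAC subrr add0r.
  apply: le_measure; rewrite ?inE//.
  move=> _ [d _ <-] /=; rewrite in_itv/= lerDl lerD2l.
  by rewrite mulr_ge0 ?digit_value_ge0 ?(ltW r0)//= ler_wpM2l ?digit_value_le// ltW.
have rx : 0 < r * x by rewrite mulr_gt0.
apply: (@le_trans _ _ (nu (piece a (r * x)) + nu (piece (a + r)%R (r * x)))%E).
  apply: (@le_trans _ _ (nu (piece a (r * x) `|` piece (a + r) (r * x)))).
    by apply: le_measure; rewrite ?inE//; exact: measurableU.
  exact: measureU2.
apply: le_trans (leeD (IH _ _ rx) (IH _ _ rx)) _.
rewrite -EFinD lee_fin le_eqVlt; apply/orP; left; apply/eqP.
by rewrite exprS; field; lra.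
Qed.

Lemma cantor_set_shift_null t : nu [set y | cantor_set (y - t)] = 0%E.
Proof.
have -> : [set y | cantor_set (y - t)] = piece t 1.
  apply/seteqP; split => y /=.
    by move=> [d _ dy]; exists d => //; rewrite mul1r dy subrKC.
  by move=> [d _ <-]; exists d => //; rewrite mul1r addrAC subrr add0r.
apply/eqP; rewrite -measure_le0; apply/lee_addgt0Pr => e e0; rewrite add0e.
have x1' : 0 < 1 - x by rewrite subr_gt0.
have c0 : 0 < e * (1 - x) by rewrite mulr_gt0.
have : geometric 1 (2 * x) @ \oo --> 0.
  by apply: cvg_geometric; rewrite gtr0_norm ?mulr_gt0//; have := x12; lra.
move=> /cvgr0Pnorm_le/(_ _ c0)[n _ /(_ n (leqnn n))]; rewrite /= mul1r => h.
apply: le_trans (piece_measure n t ltr01) _; rewrite lee_fin mul1r.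
by rewrite ler_pdivrMr//; apply: le_trans h; exact: ler_norm.
Qed.

Definition cantor_segment : set (R * R) := [set (0, c) | c in cantor_set].

Lemma compact_cantor_segment : compact cantor_segment.
Proof.
apply: continuous_compact; last exact: compact_cantor_set.
apply: continuous_subspaceT => c.
by apply: (@cvg_pair _ _ _ (nbhs c) (nbhs (0 : R)) (nbhs c));
  [exact: cvg_cst|exact: cvg_id].
Qed.

(** The segment is vertical, so each vertical section of the sum is contained
    in a single translate of the Cantor set. *)
Lemma cantor_segment_sum_null a b gamma :
  plane_lebesgue (minkowski_sum cantor_segment (graph_on a b gamma)) = 0%E.
Proof.
rewrite /plane_lebesgue /product_measure1; apply: integral0_eq => t _ /=.
have mC : measurable ([set y | cantor_set (y - gamma t)] : set mR).
  rewrite -[X in measurable X]setTI.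
  apply: (measurable_shift (gamma t) measurableT).
  by apply: compact_measurable; exact: compact_cantor_set.
apply/eqP; rewrite -measure_le0 -(cantor_set_shift_null (gamma t)).
have sub : xsection (minkowski_sum cantor_segment (graph_on a b gamma)) t `<=`
    [set y | cantor_set (y - gamma t)].
  move=> y; rewrite xsectionE => -[_ [c Cc <-]] [_ [u _ <-]] [].
  by rewrite /= add0r => -> <-; rewrite addrK.
have [tab|tab] := boolP (t \in `[a, b]).
  have -> : xsection (minkowski_sum cantor_segment (graph_on a b gamma)) t =
      [set y | cantor_set (y - gamma t)] => //.
  apply/seteqP; split => // y /= Cy; rewrite xsectionE.
  exists (0, y - gamma t); first by exists (y - gamma t).
  exists (t, gamma t); first by exists t.
  by rewrite /= ; congr (_, _); rewrite /= ?add0r ?subrK.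
rewrite (_ : xsection _ _ = set0) ?measure0//.
apply/seteqP; split => // y; rewrite xsectionE => -[_ [c Cc <-]] [_ [u uab <-]] [].
by rewrite /= add0r => ut _; exfalso; move: tab; rewrite -ut => /negP; apply.
Qed.

Variable s : R.
Hypothesis xs : x `^ s = 2^-1.

Let sep := (1 - 2 * x) / (1 - x).

(** Reading the digits of a point of the Cantor set in base two is a Hoelder
    map: at the first differing digit [m], the distances are comparable to
    [x ^+ m] and [2^-1 ^+ m = (x ^+ m) `^ s]. *)
Lemma digit_value_hoelder (u : R) (d e : nat -> bool) : 0 <= u -> u <= s ->
  `|digit_value 2^-1 d - digit_value 2^-1 e| <=
  2 * (`|digit_value x d - digit_value x e| / sep) `^ u.
Proof.
move=> u0 us.
have [[n den]|de] := pselect (exists n, d n != e n); last first.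
  have -> : d = e.
    apply/funext => n; apply/eqP/negPn/negP => den; apply: de; by exists n.
  by rewrite subrr normr0 mulr_ge0// powR_ge0.
have ex : exists n, d n != e n by exists n.
case: (ex_minnP ex) => m dem mmin.
have agree i : (i < m)%N -> d i = e i.
  by move=> im; apply/eqP/negPn/negP => /mmin; rewrite leqNgt im.
have h1 : (2^-1 : R) < 1 by rewrite invf_lt1// ltr1n.
have h0 : (0 : R) < 2^-1 by rewrite invr_gt0.
have le1 := digit_value_dist_le h0 h1 agree.
have sep0 : 0 < sep by rewrite divr_gt0//; have := x12; have := x1; lra.
have ge1 := digit_value_dist_ge x0 x12 agree (elimN eqP dem).
apply: le_trans le1 _.
have -> : (1 - 2^-1 : R)^-1 = 2 by field.
rewrite mulrC; apply: ler_wpM2l => //.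
apply: (@le_trans _ _ ((x ^+ m) `^ u)); last first.
  apply: ge0_ler_powR => //; rewrite ?nnegrE ?exprn_ge0 ?(ltW x0)//.
    by rewrite divr_ge0// ltW.
  by rewrite ler_pdivlMr.
have -> : 2^-1 ^+ m = (x ^+ m) `^ s.
  by rewrite powR_exprn ?(ltW x0)// xs.
apply: ger_powR => //; rewrite exprn_gt0//= exprn_ile1// ltW//.
Qed.

(** The Hoelder map turns a cover of the Cantor set into a cover of an
    interval of length [2], whose total length is at least [2]. *)
Lemma cantor_segment_hausdorff_measure (u : R) : 0 <= u -> u <= s ->
  hausdorff_measure u cantor_segment != 0%E.
Proof.
move=> u0 us; apply/eqP => H0.
have sep0 : 0 < sep by rewrite divr_gt0//; have := x12; have := x1; lra.
pose kap := 2 / sep `^ u.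
have kap0 : 0 < kap by rewrite divr_gt0// powR_gt0.
(* A cover of cost [eps] would give intervals of total length [1]. *)
pose eps := (2 * kap)^-1.
have eps0 : 0 < eps by rewrite invr_gt0 mulr_gt0.
have pre : (hausdorff_premeasure u 1 cantor_segment < eps%:E)%E.
  apply: (@le_lt_trans _ _ 0%E); last by rewrite lte_fin.
  by rewrite -H0; apply: ereal_sup_ubound; exists 1 => //=.
have [_ [U [EU Ud] <-] sumU] := ereal_inf_lt pre.
have finU i : diam_pow u (U i) \is a fin_num.
  rewrite ge0_fin_numE ?diam_pow_ge0//.
  by apply: le_lt_trans (le_diam_pow u0 ler01 (Ud i)) _; exact: ltry.
pose D i := fine (diam_pow u (U i)).
have J i : exists c : R, forall d, U i (0, digit_value x d) ->
    `|digit_value 2^-1 d - c| <= kap * D i.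
  have [[e eU]|ne] := pselect (exists e, U i (0, digit_value x e)); last first.
    by exists 0 => d dU; exfalso; apply: ne; exists d.
  exists (digit_value 2^-1 e) => d dU.
  apply: le_trans (digit_value_hoelder d e u0 us) _.
  have dU0 : (0 <= diam (U i))%E by apply: diam_ge0; exists (0, digit_value x e).
  have dfin : diam (U i) \is a fin_num.
    by rewrite ge0_fin_numE//; apply: le_lt_trans (Ud i) _; exact: ltry.
  have := diam_ge dU eU; rewrite /plane_dist/= subrr expr0n/= add0r sqrtr_sqr.
  rewrite -(fineK dfin) lee_fin => hd.
  have -> : D i = fine (diam (U i)) `^ u.
    rewrite /D /diam_pow ifF; first by rewrite -[in LHS](fineK dfin) poweR_EFin.
    by apply/negbTE/set0P; exists (0, digit_value x e).
  rewrite powRM ?invr_ge0 ?(ltW sep0)//.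
  rewrite -powR_inv1 ?(ltW sep0)// -powRrM mulN1r powRN.
  rewrite /kap -mulrA [_^-1 * _]mulrC.
  apply: ler_wpM2l => //; apply: ler_wpM2r; first by rewrite invr_ge0 powR_ge0.
  by apply: ge0_ler_powR; rewrite ?nnegrE// fine_ge0.
have [c cP] := choice J.
have D0 i : 0 <= D i by rewrite fine_ge0 ?diam_pow_ge0.
pose V i : set mR := `[c i - kap * D i, c i + kap * D i]%classic.
have VE i : nu (V i) = ((2 * kap)%:E * diam_pow u (U i))%E.
  rewrite -(fineK (finU i)) -/(D i) /V lebesgue_measure_itv/= lte_fin.
  have kD : 0 <= kap * D i by rewrite mulr_ge0// ltW.
  case: ifPn => h; first by rewrite -EFinB -EFinM; congr EFin; ring.
  rewrite -leNgt in h; have kD0 : kap * D i = 0 by lra.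
  by rewrite -EFinM -mulrA kD0 mulr0.
have cover : `[0, 2]%classic `<=` \bigcup_i V i.
  move=> y /=; rewrite in_itv/= => /andP[y0 y2].
  have [d dy] := binary_expansion y0 y2.
  have [i _ Ui] : (\bigcup_i U i) (0, digit_value x d).
    by apply: EU; exists (digit_value x d) => //; exists d.
  exists i => //; rewrite /V /= in_itv/= -ler_distl -dy.
  exact: cP.
have mV i : measurable (V i) by exact: measurable_itv.
have : (nu `[0%R, 2%R]%classic <= \sum_(0 <= i <oo) nu (V i))%E.
  apply: (measure_sigma_subadditive nu) => //; exact: measurable_itv.
rewrite lebesgue_measure_itv/= lte_fin ltr0n/= oppr0 adde0.
under eq_eseriesr do rewrite VE.
rewrite nneseriesZl; last by move=> *; exact: diam_pow_ge0.
move=> h.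
have : (2%:E <= (2 * kap)%:E * eps%:E)%E.
  apply: le_trans h _; apply: lee_wpmul2l; last exact: ltW.
  by rewrite lee_fin mulr_ge0// ltW.
rewrite -EFinM /eps divff; last by rewrite gt_eqF// mulr_gt0.
by rewrite lee_fin leNgt ltr1n.
Qed.

Lemma cantor_segment_dim_ge : (s%:E <= hausdorff_dim cantor_segment)%E.
Proof.
apply: le_ereal_inf_tmp => _ [u [u0 H0] <-]; rewrite lee_fin leNgt; apply/negP => us.
by have := cantor_segment_hausdorff_measure u0 (ltW us); rewrite H0 eqxx.
Qed.

End CantorSet.

(** * The threshold *)

Theorem theorem1p5 (R : realType) (a b : R) (gamma k : R -> R)
    (D2gamma : {finite_measure set (measurableTypeR R) -> \bar R})
    (kappa_s : {measure set (measurableTypeR R) -> \bar R})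
    (ab : a < b)
    (gamma_convex : convex_function `[a, b] gamma)
    (gamma_lipschitz : [lipschitz gamma x | x in `[a, b]])
    (D2gammaP : is_D2 a b gamma D2gamma)
    (decomposition : lebesgue_decomposition a b D2gamma k kappa_s)
    (k_pos : (0 < lebesgue_measure (`]a, b[ `&` [set x | (0 < k x)%R]))%E) :
  curve_threshold (graph_on a b gamma) = 1%E.
Proof.
apply/eqP; rewrite eq_le; apply/andP; split.
  apply: ereal_inf_lbound; exists 1 => // E cE dE.
  exact: (sum_with_curve_gt0 ab gamma_convex gamma_lipschitz D2gammaP
    decomposition k_pos cE dE).
apply: le_ereal_inf_tmp => _ [t tP <-]; rewrite lee_fin leNgt; apply/negP => t1.
(* A Cantor set of dimension [s] strictly between [t] and [1]: the ratio [x] solves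
   [2 * x `^ s = 1]. *)
pose s := (Num.max t 0 + 1) / 2.
have [ts s0 s1] : [/\ t < s, 0 < s & s < 1].
  by rewrite /s; case: (leP t 0) => ?; split; lra.
pose x : R := 2^-1 `^ s^-1.
have h0 : (0 : R) < 2^-1 by rewrite invr_gt0.
have h1 : (2^-1 : R) < 1 by rewrite invf_lt1// ltr1n.
have x0 : 0 < x by rewrite powR_gt0.
have xs : x `^ s = 2^-1 by rewrite -powRrM mulVf ?gt_eqF// powRr1// ltW.
have x12 : x < 2^-1.
  by apply: powR_half_lt; rewrite invf_gt1.
have dim : (t%:E < hausdorff_dim (cantor_segment x))%E.
  apply: lt_le_trans (cantor_segment_dim_ge x0 x12 xs).
  by rewrite lte_fin.
have := tP _ (compact_cantor_segment x0 x12) dim.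
by rewrite cantor_segment_sum_null// ltxx.
Qed.
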